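(* Let $\kappa$ and $\iota$ be probability measures on $\{0,1\}$ with $\kappa(\{1\}), \iota(\{1\}) \in (0,1)$ and $\iota(\{1\}) < \kappa(\{1\})$. Let $G$ be a free group of rank at least two. Then there exists an equivariant thinning from $\kappa$ to $\iota$ over $G$; that is, there exists a measurable map $\phi: \{0,1\}^G \to \{0,1\}^G$ such that: (i) $\phi(x)(g) \leq x(g)$ for all $x \in \{0,1\}^G$ and all $g \in G$; (ii) the push-forward of the product measure $\kappa^G$ under $\phi$ is the product measure $\iota^G$; and (iii) $\phi$ is equivariant $\kappa^G$-almost surely, that is, there is a set of full $\kappa^G$-measure on which $\phi(gx) = g\phi(x)$ for all $g \in G$.
   Context: The space $\{0,1\}^G$ carries the product $\sigma$-algebra, and $\kappa^G$, $\iota^G$ denote the product measures on it. The group $G$ acts on $\{0,1\}^G$ by $(gx)(f) = x(g^{-1}f)$ for $x \in \{0,1\}^G$ and $g, f \in G$; the system $(G, \{0,1\}^G, \kappa^G)$ is the Bernoulli shift over $G$ with base $(\{0,1\}, \kappa)$. The number $\kappa(\{1\}) \in (0,1)$ is called the intensity of $\kappa$. *)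

(* Defs.v *)
From HB Require Import structures.
From mathcomp Require Import all_boot all_order all_algebra.
From mathcomp Require Import all_classical all_reals all_analysis.
From mathcomp Require Import lra.

Set Implicit Arguments.
Unset Strict Implicit.
Unset Printing Implicit Defensive.

Import Order.TTheory GRing.Theory Num.Theory.

Local Open Scope classical_set_scope.
Local Open Scope ring_scope.

(* A word is a sequence of letters [(s, e)], standing for [s] if [e = true] and
   for [s^-1] if [e = false]. *)
Definition word_eval (G : groupType) (w : seq (G * bool)) : G :=
  (\prod_(l <- w) (if l.2 then l.1 else l.1^-1))%g.

Definition reduced (G : groupType) (w : seq (G * bool)) : bool :=
  sorted [rel k l | ~~ ((k.1 == l.1) && (k.2 != l.2))] w.

(* [G] is free on [S]: every element is the value of exactly one reduced word
   in the letters [s], [s^-1] with [s] in [S].  The rank of [G] is then the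
   cardinality of [S], which may be infinite. *)
Definition free_basis (G : groupType) (S : set G) : Prop :=
  forall g : G, exists! w : seq (G * bool),
    [/\ forall l, l \in w -> S l.1, reduced w & word_eval w = g].

Definition config (I : choiceType) : Type := I -> bool.

HB.instance Definition _ (I : choiceType) := Pointed.on (config I).

Definition config_display : measure_display. Proof. exact. Qed.

Definition product_sigma_algebra (I : choiceType) : set (set (config I)) :=
  <<s \bigcup_i preimage_set_system setT (fun x : config I => x i) measurable >>.

Section config_measurable.
Variable I : choiceType.

Let psa0 : @product_sigma_algebra I set0.
Proof. exact: sigma_algebra0. Qed.

Let psaC (A : set (config I)) :
  product_sigma_algebra A -> product_sigma_algebra (~` A).
Proof. exact: sigma_algebraC. Qed.

Let psaU (F : (set (config I))^nat) :
  (forall i, product_sigma_algebra (F i)) ->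
  product_sigma_algebra (\bigcup_i F i).
Proof. exact: sigma_algebra_bigcup. Qed.

HB.instance Definition _ := @isMeasurable.Build config_display (config I)
  (@product_sigma_algebra I) psa0 psaC psaU.

End config_measurable.

Definition translate (G : groupType) (g : G) (x : config G) : config G :=
  fun f => x (g^-1 * f)%g.

(* The product measure is built by Caratheodory extension from the ring of
   finite-dimensional cylinders, i.e. the sets determined by finitely many
   coordinates; [product_measureE] below characterises it. *)
Definition depends (I : choiceType) (T : Type) (s : seq I)
    (h : config I -> T) : Prop :=
  forall x y, (forall i, i \in s -> x i = y i) -> h x = h y.

Definition cylinder (I : choiceType) : set (set (config I)) :=
  [set A | exists s : seq I, depends s A].

Definition cylinder_type (I : choiceType) : Type := config I.

HB.instance Definition _ (I : choiceType) := Pointed.on (cylinder_type I).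

Definition cylinder_display : measure_display. Proof. exact. Qed.

Section cylinder_ring.
Variable I : choiceType.

Let cylinder0 : @cylinder I set0.
Proof. by exists [::]. Qed.

Let cylinderU : setU_closed (@cylinder I).
Proof.
move=> A B [s sA] [t tB]; exists (s ++ t) => x y xy; rewrite /setU /=.
rewrite [A x](sA x y) => [|i si]; last by apply: xy; rewrite mem_cat si.
by rewrite [B x](tB x y) => // i ti; apply: xy; rewrite mem_cat ti orbT.
Qed.

Let cylinderD : setD_closed (@cylinder I).
Proof.
move=> A B [s sA] [t tB]; exists (s ++ t) => x y xy; rewrite /setD /=.
rewrite [A x](sA x y) => [|i si]; last by apply: xy; rewrite mem_cat si.
by rewrite [B x](tB x y) => // i ti; apply: xy; rewrite mem_cat ti orbT.
Qed.

HB.instance Definition _ := @isRingOfSets.Build cylinder_display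
  (cylinder_type I) (@cylinder I) cylinder0 cylinderU cylinderD.

End cylinder_ring.

Section cylinder_content.
Context (R : realType) (I : choiceType).
Variable kappa : probability bool R.

Let p (b : bool) : R := fine (kappa [set b]).

Let p_ge0 b : 0 <= p b.
Proof. exact/fine_ge0/measure_ge0. Qed.

Let pE b : (p b)%:E = kappa [set b].
Proof. by rewrite fineK// fin_num_measure. Qed.

Let p1 : p true + p false = 1.
Proof.
apply/EFin_inj; rewrite EFinD !pE -measureU//.
  by rewrite -(probability_setT kappa) setT_bool.
by apply/seteqP; split => // -[] [].
Qed.

Definition update (i : I) (b : bool) (x : config I) : config I :=
  fun j => if j == i then b else x j.

(* Average over the coordinate [i], respectively over all coordinates in [s]. *)
Definition average1 (i : I) (h : config I -> R) : config I -> R :=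
  fun x => p true * h (update i true x) + p false * h (update i false x).

Definition average (s : seq I) (h : config I -> R) : config I -> R :=
  foldr average1 h s.

Definition cylinder_content (A : set (cylinder_type I)) : \bar R :=
  (average (xget [::] [set s : seq I | depends s A]) (\1_A) point)%:E.

Let average1C i j h : average1 i (average1 j h) = average1 j (average1 i h).
Proof.
have [->//|ij] := eqVneq i j.
apply/funext => x; rewrite /average1.
have E b c : update j b (update i c x) = update i c (update j b x).
  apply/funext => k; rewrite /update.
  by have [->|//] := eqVneq k j; rewrite eq_sym (negPf ij).
by rewrite !E; lra.
Qed.

Let averageC s t h : average s (average t h) = average t (average s h).
Proof.
have C1 i u h' : average1 i (average u h') = average u (average1 i h').
  by elim: u => //= j u IH; rewrite average1C IH.
by elim: s => //= i s ->; rewrite C1.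
Qed.

Let average1_cst i h : (forall x y, h x = h y) -> average1 i h = h.
Proof.
move=> hc; apply/funext => x; rewrite /average1 (hc _ x) (hc (update i false x) x).
by rewrite -mulrDl p1 mul1r.
Qed.

Let average_cst s h : (forall x y, h x = h y) -> average s h = h.
Proof. by move=> hc; elim: s => //= i s ->; rewrite average1_cst. Qed.

Let average_depends s t (h : config I -> R) :
  depends (s ++ t) h -> depends t (average s h).
Proof.
elim: s t => //= i s IH t hst x y xy; rewrite /average1.
have {IH}sh : depends (i :: t) (average s h).
  apply: IH => x' y' xy'; apply: hst => k; move=> ks.
  by apply: xy'; move: ks; rewrite !(inE, mem_cat) orbCA.
by congr (_ * _ + _ * _); apply: sh => k; rewrite !inE /update;
  have [//|_ /= kt] := eqVneq k i; apply: xy.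
Qed.

Let average_const s (h : config I -> R) :
  depends s h -> forall x y, average s h x = average s h y.
Proof.
move=> hs x y; apply: (@average_depends s [::]) => // x' y' xy.
by apply: hs => i si; apply: xy; rewrite cats0.
Qed.

Let average_indep s t (h : config I -> R) x y :
  depends s h -> depends t h -> average s h x = average t h y.
Proof.
move=> hs ht; rewrite -(average_cst t (average_const hs)) averageC.
by rewrite (average_cst s (average_const ht)); exact: average_const.
Qed.

Let depends_indic s (A : set (config I)) :
  depends s A -> depends s (\1_A : config I -> R).
Proof.
move=> As x y xy; rewrite !indicE; congr ((_ : bool)%:R).
by apply/idP/idP; rewrite !inE (As x y xy).
Qed.

Let average_ge0 s h : (forall x, 0 <= h x) -> forall x, 0 <= average s h x.
Proof.
by move=> h0; elim: s => //= i s IH x; rewrite addr_ge0// mulr_ge0.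
Qed.

Let averageD s h k :
  average s (fun x => h x + k x) = fun x => average s h x + average s k x.
Proof.
elim: s => //= i s ->; apply/funext => x; rewrite /average1; lra.
Qed.

Lemma cylinder_contentE s (A : set (config I)) x :
  depends s A -> cylinder_content A = (average s (\1_A) x)%:E.
Proof.
move=> sA; congr EFin; apply: average_indep; apply: depends_indic => //.
exact: (@xgetPex _ [::] [set s : seq I | depends s A] (ex_intro _ s sA)).
Qed.

Let content_ge0 A : (0 <= cylinder_content A)%E.
Proof. by rewrite lee_fin; apply: average_ge0 => x; rewrite indicE. Qed.

Let content0 : cylinder_content set0 = 0%E.
Proof.
rewrite (@cylinder_contentE [::] set0 point)//=.
by rewrite indicE in_set0.
Qed.

Let content_semi_additive : measure_function.semi_additive cylinder_content.
Proof.
apply/(additive2P content0) => A B [s sA] [t tB] AB.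
have catl : depends (s ++ t) A.
  by move=> x y xy; apply: sA => i si; apply: xy; rewrite mem_cat si.
have catr : depends (s ++ t) B.
  by move=> x y xy; apply: tB => i si; apply: xy; rewrite mem_cat si orbT.
have catU : depends (s ++ t) (A `|` B).
  by move=> x y xy; rewrite /setU /= (catl x y xy) (catr x y xy).
rewrite (cylinder_contentE point catl) (cylinder_contentE point catr).
rewrite (cylinder_contentE point catU) -EFinD; congr EFin.
rewrite -[RHS](congr1 (@^~ point) (averageD (s ++ t) (\1_A) (\1_B))).
congr (average _ _ _); apply/funext => x; rewrite !indicE in_setU.
have [/set_mem Ax|_] := boolP (x \in A); last by rewrite add0r.
suff -> : (x \in B) = false by rewrite addr0.
apply: memNset => Bx; suff : set0 x by [].
by rewrite -AB.
Qed.

HB.instance Definition _ := isContent.Build cylinder_display (cylinder_type I) R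
  cylinder_content content_ge0 content_semi_additive.

(* Cylinders are clopen in the compact product topology. *)
Let cylinder_open (A : set (config I)) : cylinder A ->
  open (A : set (prod_topology (fun _ : I => bool))).
Proof.
move=> [s sA]; rewrite openE => x Ax.
have : \forall y \near (x : prod_topology (fun _ : I => bool)),
    forall i, i \in s -> x i = y i.
  elim: s {sA} => [|i s IH]; first exact: filterE.
  have xi : \forall y \near (x : prod_topology (fun _ : I => bool)), y i = x i.
    exact: (@proj_continuous I (fun=> bool) i x _ (discrete_set1 (x i))).
  apply: filterS2 xi IH => y yi ys j; rewrite inE => /predU1P[->//|].
  exact: ys.
by apply: filterS => y xy; rewrite -(sA x y xy).
Unshelve. all: by end_near. Qed.

Let content_sigma_subadditive :
  measurable_subset_sigma_subadditive cylinder_content.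
Proof.
move=> A F mF mA AF.
pose X := prod_topology (fun _ : I => bool).
have cX : compact [set: X].
  have := @tychonoff I (fun=> bool) (fun=> setT) (fun=> bool_compact).
  by congr compact; apply/seteqP; split.
have cA : compact (A : set X).
  apply: (subclosed_compact _ cX) => //.
  rewrite -openC; apply: cylinder_open.
  by have [s sA] := mA; exists s => x y xy; rewrite /setC /= (sA x y xy).
have /compact_near_coveringP/(_ nat \oo
    (fun n x => exists2 i, (i < n)%N & F i x)) := cA.
move=> /(_ _ _)[x Ax|n _ /(_ n (leqnn n)) An].
  have [i _ Fix] := AF x Ax.
  exists (F i, [set n | (i < n)%N]); last by move=> [y n] [/= Fiy iltn]; exists i.
  split; last exact: nbhs_infty_gt.
  by have := cylinder_open (mF i); rewrite openE; apply.
apply: (le_trans _ (nneseries_lim_ge n _)) => //.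
rewrite big_mkord; apply: content_subadditive => // x /An[i iltn Fix].
by rewrite -bigcup_mkord; exists i.
Qed.

HB.instance Definition _ := Content_SigmaSubAdditive_isMeasure.Build
  cylinder_display R (cylinder_type I) cylinder_content
  content_sigma_subadditive.

Definition product_measure : set (config I) -> \bar R :=
  @mu_ext _ (cylinder_type I) R cylinder_content.

Let sub_cara (A : set (config I)) : measurable A ->
  caratheodory_measurable product_measure A.
Proof.
move=> mA; apply: (@sub_caratheodory _ _ _ cylinder_content).
move: A mA; apply: smallest_sub; first exact: smallest_sigma_algebra.
move=> _ [i _ [B mB <-]]; apply: sub_sigma_algebra; exists [:: i] => x y xy.
by rewrite setTI /preimage /= (xy i)// mem_head.
Qed.

Let product_measure0 : product_measure set0 = 0%E.
Proof. exact: mu_ext0. Qed.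

Let product_measure_ge0 (A : set (config I)) : (0 <= product_measure A)%E.
Proof. exact: mu_ext_ge0. Qed.

Let product_measure_sigma_additive : semi_sigma_additive product_measure.
Proof.
move=> F mF tF mUF.
apply: caratheodory_measure_sigma_additive => // [i|]; exact: sub_cara.
Qed.

HB.instance Definition _ := isMeasure.Build config_display (config I) R
  product_measure product_measure0 product_measure_ge0
  product_measure_sigma_additive.

Let product_measureT : product_measure setT = 1%E.
Proof.
have mT : cylinder (setT : set (config I)) by exists [::].
apply: (etrans (measurable_mu_extE cylinder_content mT)).
apply: (etrans (@cylinder_contentE [::] setT point _)) => //=.
by rewrite indicE in_setT.
Qed.

HB.instance Definition _ := Measure_isProbability.Build config_display
  (config I) R product_measure product_measureT.

Let kappaE (B : set bool) :
  kappa B = (p true * (true \in B)%:R + p false * (false \in B)%:R)%:E.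
Proof.
have kappa1 b : kappa (B `&` [set b]) = (p b * (b \in B)%:R)%:E.
  have [bB|/negP bB] := boolP (b \in B).
    rewrite mulr1 pE; congr (kappa _); apply/setIidr => x /= ->.
    exact: set_mem bB.
  rewrite mulr0 (_ : B `&` _ = set0) ?measure0//.
  by apply/seteqP; split => // x [Bx /= xb]; apply: bB; rewrite -xb mem_set.
rewrite EFinD -!kappa1 -measureU//.
  by rewrite -setIUr -setT_bool setIT.
by apply/seteqP; split => // x [[_ /= ->] [_ /=]].
Qed.

Let average_prod s (g : I -> bool -> R) (k : config I -> R) : uniq s ->
    (forall i b x, i \in s -> k (update i b x) = k x) ->
  average s (fun x => k x * \prod_(i <- s) g i (x i)) =
  fun x => k x * \prod_(i <- s) (p true * g i true + p false * g i false).
Proof.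
elim: s k => [|i s IH] k; first by move=> _ _ /=; apply/funext => x; rewrite !big_nil.
rewrite cons_uniq => /andP[iNs us] ks /=; apply/funext => x.
under [in LHS]eq_fun do rewrite big_cons mulrA.
rewrite (IH (fun x => k x * g i (x i)))//; last first.
  move=> j b y js; rewrite ks ?inE ?js ?orbT// /update.
  by rewrite ifN//; apply: contraNneq iNs => ->.
rewrite /average1 !ks ?mem_head// big_cons /update eqxx; lra.
Qed.

(* The defining property of the product measure. *)
Lemma product_measureE (s : seq I) (B : I -> set bool) : uniq s ->
  product_measure [set x | forall i, i \in s -> B i (x i)] =
  (\prod_(i <- s) kappa (B i))%E.
Proof.
move=> us; set A := [set x : config I | _].
have sA : depends s A.
  by move=> x y xy; apply/propext; split=> Ax i si;
    have := Ax i si; rewrite xy.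
have mA : cylinder A by exists s.
apply: (etrans (measurable_mu_extE cylinder_content mA)).
apply: (etrans (cylinder_contentE point sA)).
have -> : (\1_A : config I -> R) =
    fun x => 1 * \prod_(i <- s) (x i \in B i)%:R.
  apply/funext => x; rewrite mul1r indicE big_seq.
  have [/set_mem Ax|/negP AxN] := boolP (x \in A).
    by rewrite big1// => i si; rewrite mem_set//; exact: Ax.
  apply/esym/eqP; rewrite -big_seq prodf_seq_eq0; apply: contrapT => /negP.
  rewrite -all_predC => /allP h; apply: AxN; apply/mem_set => i /h /=.
  by rewrite pnatr_eq0 eqb0 negbK => /set_mem.
rewrite (@average_prod s (fun i b => (b \in B i)%:R) (fun=> 1))//.
by rewrite mul1r -prodEFin; apply: eq_bigr => i _; rewrite kappaE.
Qed.

End cylinder_content.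

(* Main.v *)
Require Import Defs.
From HB Require Import structures.
From mathcomp Require Import all_boot all_order all_algebra.
From mathcomp Require Import all_classical all_reals all_analysis.
From mathcomp Require Import measurable_realfun ring lra zify.

Set Implicit Arguments.
Unset Strict Implicit.
Unset Printing Implicit Defensive.

Import Order.TTheory GRing.Theory Num.Theory.
Import numFieldNormedType.Exports.

Local Open Scope classical_set_scope.
Local Open Scope ring_scope.

(** Write p and q for the intensities of kappa and iota, and r = q / p. Given an
    independent coin of bias r at every site, keeping a 1 exactly when its coin
    shows heads turns kappa^G into iota^G. No coins are given, so they have to
    be extracted from x itself, in such a way that the output does not reveal
    what was extracted. Two ideas make this possible.

    Hiding a fair bit. Along the cosets g<a> look for the pattern
    1^(m+3) 0 v 0, with v a free word of length m + 2. Two occurrences never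
    overlap, whatever the free words are ([occ_nonoverlap]), so the free words
    are independent of the places where they stand. Call an occurrence special
    when v is 10 0^m or 01 0^m. The order of the first two letters is then a
    fair bit, and erasing both letters makes the output blind to it. The
    erasure removes some mass from the outputs 10 0^m and 01 0^m; that mass is
    put back at occurrences where v starts with 11 but the plain thinning erases
    the whole of v. There, with probability theta, one of the first two letters
    is kept after all, chosen by a fair coin. Since special words have
    probability of order (1 - p)^m, while the plain thinning erases the last m
    letters with probability (1 - q)^m, a suitable theta <= 1 exists for large
    m ([compensation_exists]), and the modified thinning still produces iota^G
    from independent coins ([avg_all_thin]).

    Amplifying the bits. This is where the free group enters, through the map
    of Ornstein and Weiss. Let a' be a second generator. Join each special site
    k to the first special site at or after k a, and to the first one at or
    after k a', both searched for along a-lines. Because the Cayley graph of a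
    free group is a tree, these edges form a forest, and the increments of a
    family of independent fair bits along the edges of a forest are again
    independent and fair. So one bit per special site has become two; keeping
    one and iterating on the other yields infinitely many bits per special site,
    and each site g is served by the next special site on its a-line.
    Algebraically, every system of increments can be integrated ([gradient]), so
    any finite set of the extracted bits can be prescribed ([bits_separated]).

    Putting the ideas together. Exchanging the two letters of a special
    occurrence preserves kappa^G, the set of special sites and the output, and
    flips one hidden bit. Hence the character of a nonempty set of extracted
    bits has zero expectation against any function that is invariant under all
    exchanges ([expect_sign_parity]), and by Fourier expansion the extracted
    bits are fair, independent of each other and of all such functions
    ([expect_fair_bits]). Coins of any bias are tossed with fair bits
    ([coin]), and the thinning driven by the extracted coins has the same law as
    the thinning driven by independent ones ([expect_combine]). All the choices
    are made by right multiplication, so the resulting map commutes with every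
    left translation on the whole space. *)

(** * Integrating increments on a free group *)

Section gradient.
Context (G : groupType) (S : set G) (S_basis : free_basis S).
Context (V : zmodType) (f : G -> G -> V).

Definition letter (l : G * bool) : G := if l.2 then l.1 else (l.1^-1)%g.

(** The letter s^-1 is the edge from g s^-1 to g walked backwards; hence the sign
    and the base point. *)
Definition step (g : G) (l : G * bool) : V :=
  if l.2 then f l.1 g else - f l.1 (g * l.1^-1)%g.

Fixpoint path_sum (g : G) (w : seq (G * bool)) : V :=
  if w is l :: w' then step g l + path_sum (g * letter l)%g w' else 0.

Lemma word_eval_rcons (w : seq (G * bool)) l :
  word_eval (rcons w l) = (word_eval w * letter l)%g.
Proof. by rewrite /word_eval -cats1 big_cat big_seq1. Qed.

Lemma word_eval_cons (w : seq (G * bool)) l :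
  word_eval (l :: w) = (letter l * word_eval w)%g.
Proof. by rewrite /word_eval big_cons. Qed.

Lemma path_sum_rcons g (w : seq (G * bool)) l :
  path_sum g (rcons w l) = path_sum g w + step (g * word_eval w)%g l.
Proof.
elim: w g => [|k w IH] g /=.
  by rewrite /word_eval big_nil mulg1 addr0 add0r.
by rewrite IH word_eval_cons mulgA addrA.
Qed.

Lemma reduced_rcons (w : seq (G * bool)) l l' :
  reduced (rcons (rcons w l) l') =
  reduced (rcons w l) && ~~ ((l.1 == l'.1) && (l.2 != l'.2)).
Proof.
rewrite /reduced; case: w => [|k w] /=; first by rewrite andbT.
by rewrite !rcons_path last_rcons.
Qed.

Lemma reduced_prefix (w : seq (G * bool)) l : reduced (rcons w l) -> reduced w.
Proof. by case: w => // k w; rewrite /reduced /= rcons_path => /andP[]. Qed.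

(** The Cayley graph of a free group is a tree, so every function on its edges is
    the gradient of a function on its vertices: sum the values along the reduced
    word of g. Multiplying g by s either appends s to that word or cancels its
    last letter, and in both cases the sum changes by [f s g]. *)
Lemma gradient : exists B : G -> V,
  forall g s, S s -> B (g * s)%g = B g + f s g.
Proof.
have [W HW] := choice S_basis.
exists (fun g => path_sum 1%g (W g)) => g s Ss.
have [[WS Wred Weval] _] := HW g.
have uniqW h w : (forall l, l \in w -> S l.1) -> reduced w ->
  word_eval w = h -> W h = w.
  by move=> *; have [_] := HW h; apply.
case: (lastP (W g)) WS Wred Weval => [|w [t e]] WS Wred Weval.
  rewrite (uniqW _ [:: (s, true)]) /=.
  - by move: Weval; rewrite /word_eval big_nil /step /= => <-; rewrite addr0 add0r.
  - by move=> l; rewrite inE => /eqP->.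
  - by [].
  - by rewrite -Weval /word_eval big_nil big_seq1 mul1g.
(* Either s cancels the last letter of the word of g, or it is appended. *)
case: (boolP ((t == s) && ~~ e)) => [/andP[/eqP ts /negPf e0]|nts].
  subst t e.
  have gw : (g * s)%g = word_eval w.
    by rewrite -Weval word_eval_rcons /letter /= mulgVK.
  rewrite (uniqW _ w).
  - by rewrite path_sum_rcons /step /= mul1g -gw mulgK subrK.
  - by move=> l lw; apply: WS; rewrite mem_rcons inE lw orbT.
  - exact: reduced_prefix Wred.
  - by [].
rewrite (uniqW _ (rcons (rcons w (t, e)) (s, true))).
- by rewrite [LHS]path_sum_rcons mul1g Weval.
- move=> l; rewrite mem_rcons inE => /predU1P[->//|]; exact: WS.
- rewrite reduced_rcons Wred /=; move: nts; by case: (t == s); case: e {WS Wred Weval}.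
- by rewrite word_eval_rcons Weval.
Qed.

End gradient.

(** Integrating the constant 1 over int gives a function that counts the powers
    of [a]. *)
Lemma free_expg_inj (G : groupType) (S : set G) (a : G) (i j : nat) :
  free_basis S -> S a -> (a ^+ i = a ^+ j)%g -> i = j.
Proof.
move=> S_basis Sa.
have [B HB] := gradient S_basis (fun _ _ => 1 : int).
have E k : B (a ^+ k)%g = B 1%g + k%:Z.
  elim: k => [|k IH]; first by rewrite expg0 addr0.
  by rewrite expgSr HB// IH; lia.
by move=> /(congr1 B); rewrite !E; lia.
Qed.

(** * Bounded measurable functions and their expectations *)

Section bounded_measurable.
Context d (T : measurableType d) (R : realType).

Definition mbool (f : T -> bool) := measurable_fun setT f.

Definition bounded_mfun (f : T -> R) :=
  measurable_fun setT f /\ exists C : R, forall x, `|f x| <= C.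

Lemma mbool_set (f : T -> bool) : mbool f -> measurable [set x | f x].
Proof.
move=> mf; have := mf measurableT [set true] I.
by rewrite setTI.
Qed.

Lemma set_mbool (f : T -> bool) : measurable [set x | f x] -> mbool f.
Proof. by move=> mf; apply: (measurable_fun_bool true); rewrite setTI. Qed.

Lemma mbool_cst b : mbool (fun=> b).
Proof. exact: measurable_cst. Qed.

Lemma mboolN f : mbool f -> mbool (fun x => ~~ f x).
Proof. exact: measurable_neg. Qed.

Lemma mboolI f g : mbool f -> mbool g -> mbool (fun x => f x && g x).
Proof. exact: measurable_and. Qed.

Lemma mboolU f g : mbool f -> mbool g -> mbool (fun x => f x || g x).
Proof. exact: measurable_or. Qed.

Lemma mboolX f g : mbool f -> mbool g -> mbool (fun x => f x (+) g x).
Proof.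
move=> mf mg; have -> : (fun x => f x (+) g x) =
    (fun x => (f x && ~~ g x) || (~~ f x && g x)).
  by apply/funext => x; case: (f x); case: (g x).
by apply: mboolU; apply: mboolI => //; apply: mboolN.
Qed.

Lemma mbool_if c f g : mbool c -> mbool f -> mbool g ->
  mbool (fun x => if c x then f x else g x).
Proof.
move=> mc mf mg; have -> : (fun x => if c x then f x else g x) =
    (fun x => (c x && f x) || (~~ c x && g x)).
  by apply/funext => x; case: (c x) => //=; rewrite orbF.
by apply: mboolU; apply: mboolI => //; apply: mboolN.
Qed.

Lemma mbool_exists (f : nat -> T -> bool) : (forall n, mbool (f n)) ->
  mbool (fun x => `[< exists n, f n x >]).
Proof.
move=> mf; apply: set_mbool.
rewrite (_ : [set x | _] = \bigcup_n [set x | f n x]).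
  by apply: bigcupT_measurable => n; apply: mbool_set.
apply/seteqP; split => x /=; first by move=> /asboolP[n]; exists n.
by move=> [n _ /= fn]; apply/asboolP; exists n.
Qed.

Lemma mbool_forall (f : nat -> T -> bool) : (forall n, mbool (f n)) ->
  mbool (fun x => `[< forall n, f n x >]).
Proof.
move=> mf; rewrite (_ : (fun x => _) =
  (fun x => ~~ `[< exists n, ~~ f n x >])).
  by apply: mboolN; apply: mbool_exists => n; apply: mboolN.
apply/funext => x; apply/asboolP/negP => [fx /asboolP[n]|nf n].
  by rewrite fx.
by apply: contrapT => /negP fn; apply: nf; apply/asboolP; exists n.
Qed.

Lemma mbool_all (I : Type) (s : seq I) (f : I -> T -> bool) :
  (forall i, mbool (f i)) -> mbool (fun x => all (f ^~ x) s).
Proof.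
move=> mf; elim: s => [|i s IH] /=; first exact: mbool_cst.
exact: mboolI.
Qed.

Lemma mbool_case (N : T -> nat) (f : nat -> T -> bool) :
  (forall n, mbool (fun x => N x == n)) -> (forall n, mbool (f n)) ->
  mbool (fun x => f (N x) x).
Proof.
move=> mN mf; rewrite (_ : (fun x => _) =
  (fun x => `[< exists n, (N x == n) && f n x >])).
  by apply: mbool_exists => n; apply: mboolI.
apply/funext => x; apply/idP/asboolP => [h|[n /andP[/eqP->]]//].
by exists (N x); rewrite eqxx.
Qed.

Lemma bm_cst c : bounded_mfun (fun=> c).
Proof. by split; [exact: measurable_cst|exists `|c|]. Qed.

Lemma bm_mbool (f : T -> bool) : mbool f -> bounded_mfun (fun x => (f x)%:R).
Proof.
move=> mf; split; last by exists 1 => x; case: (f x); rewrite ?normr1 ?normr0.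
rewrite (_ : (fun x => _) = (fun x => if f x then 1 else 0)).
  exact: measurable_fun_ifT.
by apply/funext => x; case: (f x).
Qed.

Lemma bmD f g : bounded_mfun f -> bounded_mfun g -> bounded_mfun (fun x => f x + g x).
Proof.
move=> [mf [C fC]] [mg [D gD]]; split; first exact: measurable_funD.
by exists (C + D) => x; apply: le_trans (ler_normD _ _) _; apply: lerD.
Qed.

Lemma bmM f g : bounded_mfun f -> bounded_mfun g -> bounded_mfun (fun x => f x * g x).
Proof.
move=> [mf [C fC]] [mg [D gD]]; split; first exact: measurable_funM.
by exists (C * D) => x; rewrite normrM ler_pM.
Qed.

Lemma bmZ c f : bounded_mfun f -> bounded_mfun (fun x => c * f x).
Proof. by move=> bf; apply: bmM => //; apply: bm_cst. Qed.

Lemma bmN f : bounded_mfun f -> bounded_mfun (fun x => - f x).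
Proof.
move=> bf; have := bmZ (-1) bf; congr bounded_mfun; apply/funext => x.
by rewrite mulN1r.
Qed.

Lemma bmB f g : bounded_mfun f -> bounded_mfun g -> bounded_mfun (fun x => f x - g x).
Proof. by move=> bf bg; apply: bmD => //; apply: bmN. Qed.

End bounded_measurable.

Section expectation.
Context d (T : measurableType d) (R : realType) (P : probability T R).

Definition expect (f : T -> R) : R := (\int[P]_x f x)%R.

Lemma bm_integrable f : bounded_mfun f -> P.-integrable setT (EFin \o f).
Proof.
move=> [mf [C fC]]; apply: measurable_bounded_integrable => //.
  by rewrite ltey_eq fin_num_measure.
exists C; split; first exact: num_real.
by move=> M CM x _; apply: le_trans (fC x) (ltW CM).
Qed.

Lemma expect_cst c : expect (fun=> c) = c.
Proof. by rewrite /expect Rintegral_cst// [X in fine X]probability_setT mulr1. Qed.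

Lemma expectD f g : bounded_mfun f -> bounded_mfun g ->
  expect (fun x => f x + g x) = expect f + expect g.
Proof. by move=> bf bg; rewrite /expect RintegralD//; exact: bm_integrable. Qed.

Lemma expectB f g : bounded_mfun f -> bounded_mfun g ->
  expect (fun x => f x - g x) = expect f - expect g.
Proof. by move=> bf bg; rewrite /expect RintegralB//; exact: bm_integrable. Qed.

Lemma expectZ c f : bounded_mfun f -> expect (fun x => c * f x) = c * expect f.
Proof. by move=> bf; rewrite /expect RintegralZl//; exact: bm_integrable. Qed.

Lemma EFin_expect f : bounded_mfun f -> (expect f)%:E = (\int[P]_x (f x)%:E)%E.
Proof.
move=> bf; rewrite /expect /Rintegral fineK//.
exact: integrable_fin_num (bm_integrable bf).
Qed.

Lemma expect_mbool (f : T -> bool) : mbool f ->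
  (expect (fun x => (f x)%:R))%:E = P [set x | f x].
Proof.
move=> mf; rewrite EFin_expect; last exact: bm_mbool.
rewrite -(setIT [set x | f x]) -integral_indic//; last exact: mbool_set.
by apply: eq_integral => x _; rewrite indicE (_ : (x \in _) = f x)//;
  apply/idP/idP; rewrite inE.
Qed.

Lemma le_expect f g : bounded_mfun f -> bounded_mfun g -> (forall x, f x <= g x) ->
  expect f <= expect g.
Proof.
by move=> bf bg fg; apply: le_Rintegral => //; exact: bm_integrable.
Qed.

(** Dominated convergence, with a constant as the dominating function. *)
Lemma expect_bounded_cvg (u : nat -> T -> R) f C :
  (forall n, bounded_mfun (u n)) -> bounded_mfun f -> (forall n x, `|u n x| <= C) ->
  (forall x, u ^~ x @ \oo --> f x) ->
  (fun n => expect (u n)) @ \oo --> expect f.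
Proof.
move=> bu bf uC uf; apply: fine_cvg; rewrite -/(Rintegral _ _ _) -/(expect f).
rewrite EFin_expect//.
have [//|||||_ _] := @dominated_convergence _ T R P setT measurableT
  (fun n => EFin \o u n) (EFin \o f) (fun=> C%:E).
- by move=> n; apply/measurable_EFinP; case: (bu n).
- by apply/measurable_EFinP; case: bf.
- by apply: aeW => x _; apply: cvg_EFin; [exact: nearW|exact: uf].
- exact: (bm_integrable (bm_cst _ C)).
- by apply: aeW => x n _; rewrite lee_fin.
by [].
Qed.

Lemma expect_le_norm f g : bounded_mfun f -> bounded_mfun g -> (forall x, `|f x| <= g x) ->
  `|expect f| <= expect g.
Proof.
move=> bf bg fg; rewrite ler_norml -mulN1r -expectZ//.
apply/andP; split; last first.
  by apply: le_expect => // x; exact: le_trans (ler_norm _) (fg x).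
apply: le_expect => // [|x]; first exact: bmZ.
by rewrite mulN1r; have := fg x; rewrite ler_norml => /andP[].
Qed.

Lemma expect_ae_eq f g (A : T -> bool) : bounded_mfun f -> bounded_mfun g -> mbool A ->
  expect (fun x => (A x)%:R) = 1 -> (forall x, A x -> f x = g x) ->
  expect f = expect g.
Proof.
move=> bf bg mA A1 fg.
have bA := @bm_mbool _ _ R _ mA.
have [_ [C fC]] := bmB bf bg.
have bA' : bounded_mfun (fun x => 1 - (A x)%:R : R) by apply: bmB => //; exact: bm_cst.
apply/eqP; rewrite -subr_eq0 -expectB// -normr_le0.
rewrite -(mulr0 C) -(subrr (1 : R)) -{2}A1 -{1}(expect_cst 1) -expectB//; last exact: bm_cst.
rewrite -expectZ//; apply: expect_le_norm => [||x]; [exact: bmB|exact: bmZ|].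
by case: (boolP (A x)) (fC x) => [/fg ->|_]; rewrite ?subrr ?normr0 ?mulr0 ?subr0 ?mulr1.
Qed.

Lemma expect_ge0 f : bounded_mfun f -> (forall x, 0 <= f x) -> 0 <= expect f.
Proof.
by move=> bf f0; rewrite -(expect_cst 0); apply: le_expect => //; exact: bm_cst.
Qed.

End expectation.

(** * Finite averages over the coordinates of a configuration *)

Section averages.
Context (R : realType) (I : choiceType).
Implicit Types (i j : I) (s t : seq I) (x y : config I) (h k : config I -> R).

(** Resampling of one coordinate. Unlike in the product measure, the weight may
    depend on the coordinate, so that the same operator serves for the input and
    for the coins. *)
Definition avg1 (mu : I -> R) i h : config I -> R :=
  fun x => mu i * h (update i true x) + (1 - mu i) * h (update i false x).

Definition avg mu s h : config I -> R := foldr (avg1 mu) h s.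

Lemma update_id i x : update i (x i) x = x.
Proof. by apply/funext => j; rewrite /update; case: eqVneq => [->|]. Qed.

Lemma updateC i j b c x : i != j ->
  update i b (update j c x) = update j c (update i b x).
Proof.
move=> ij; apply/funext => k; rewrite /update.
by have [->|//] := eqVneq k i; rewrite (negPf ij).
Qed.

Lemma update_depends (T : Type) s (h : config I -> T) i b x :
  depends s h -> i \notin s -> h (update i b x) = h x.
Proof.
move=> hs iNs; apply: hs => j js; rewrite /update ifN//.
by apply: contraNneq iNs => <-.
Qed.

Lemma sub_depends (T : Type) s t (h : config I -> T) :
  {subset s <= t} -> depends s h -> depends t h.
Proof. by move=> st hs x y xy; apply: hs => i /st; apply: xy. Qed.

Lemma depends_comp (T U : Type) s (f : T -> U) (h : config I -> T) :
  depends s h -> depends s (fun x => f (h x)).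
Proof. by move=> hs x y xy; rewrite (hs x y xy). Qed.

Lemma depends_comp2 (T U V : Type) s (f : T -> U -> V) (h : config I -> T)
    (k : config I -> U) :
  depends s h -> depends s k -> depends s (fun x => f (h x) (k x)).
Proof. by move=> hs ks x y xy; rewrite (hs x y xy) (ks x y xy). Qed.

Lemma depends_coord s i : i \in s -> depends s (fun x => x i).
Proof. by move=> si x y; apply. Qed.

Lemma depends_all (J : eqType) (r : seq J) (f : J -> config I -> bool) s :
  (forall l, l \in r -> depends s (f l)) -> depends s (fun x => all (f ^~ x) r).
Proof.
by move=> fs x y xy; apply: eq_in_all => j /fs; apply.
Qed.

Lemma avg1C mu i j h : avg1 mu i (avg1 mu j h) = avg1 mu j (avg1 mu i h).
Proof.
have [->//|ij] := eqVneq i j; apply/funext => x; rewrite /avg1.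
rewrite !(updateC _ _ _ ij); lra.
Qed.

Lemma avg1_avgC mu i s h : avg1 mu i (avg mu s h) = avg mu s (avg1 mu i h).
Proof. by elim: s => //= j s <-; rewrite avg1C. Qed.

Lemma avgC mu s t h : avg mu s (avg mu t h) = avg mu t (avg mu s h).
Proof. by elim: s => //= i s ->; rewrite avg1_avgC. Qed.

Lemma avg_cat mu s t h : avg mu (s ++ t) h = avg mu s (avg mu t h).
Proof. exact: foldr_cat. Qed.

Lemma avg1_pull mu i k h : (forall b x, k (update i b x) = k x) ->
  avg1 mu i (fun x => k x * h x) = fun x => k x * avg1 mu i h x.
Proof. by move=> ki; apply/funext => x; rewrite /avg1 !ki; ring. Qed.

Lemma avg_pull mu s k h : (forall i b x, i \in s -> k (update i b x) = k x) ->
  avg mu s (fun x => k x * h x) = fun x => k x * avg mu s h x.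
Proof.
elim: s => //= i s IH ks; rewrite IH ?avg1_pull// => [b x|j b x js];
  by apply: ks; rewrite inE ?eqxx ?js ?orbT.
Qed.

Lemma avg_cst mu s c : avg mu s (fun=> c) = fun=> c.
Proof.
by elim: s => //= i s ->; apply/funext => x; rewrite /avg1; ring.
Qed.

Lemma avg_id mu s h : (forall i b x, i \in s -> h (update i b x) = h x) ->
  avg mu s h = h.
Proof.
move=> hs; have := avg_pull mu (fun=> 1) hs; rewrite avg_cst.
under [in LHS]eq_fun do rewrite mulr1.
by move=> ->; apply/funext => x; rewrite mulr1.
Qed.

Lemma avgD mu s h k :
  avg mu s (fun x => h x + k x) = fun x => avg mu s h x + avg mu s k x.
Proof. by elim: s => //= i s ->; apply/funext => x; rewrite /avg1; ring. Qed.

Lemma avgB mu s h k :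
  avg mu s (fun x => h x - k x) = fun x => avg mu s h x - avg mu s k x.
Proof. by elim: s => //= i s ->; apply/funext => x; rewrite /avg1; ring. Qed.

Lemma avgZ mu s c h :
  avg mu s (fun x => c * h x) = fun x => c * avg mu s h x.
Proof. exact: (@avg_pull _ _ (fun=> c)). Qed.

Lemma depends_update (T : Type) s i b (h : config I -> T) :
  depends (i :: s) h -> depends s (fun x => h (update i b x)).
Proof.
move=> hs x y xy; apply: hs => j; rewrite inE /update.
by case: eqVneq => //= _; apply: xy.
Qed.

Lemma avg1_depends mu i s h : depends (i :: s) h -> depends s (avg1 mu i h).
Proof.
by move=> hs x y xy; rewrite /avg1 !(depends_update _ hs xy).
Qed.

Lemma avg_depends mu s t h : depends (s ++ t) h -> depends t (avg mu s h).
Proof.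
elim: s t => //= i s IH t hs; apply: avg1_depends; apply: IH.
by apply: sub_depends hs => j; rewrite !(inE, mem_cat) orbCA.
Qed.

Lemma avg_const mu s h x y : depends s h -> avg mu s h x = avg mu s h y.
Proof. by move=> hs; apply: (@avg_depends mu s [::]); rewrite ?cats0. Qed.

(** The average of a function does not depend on the finite set of coordinates
    used to compute it, as long as the function depends on no others. *)
Lemma avg_indep mu s t h x y : depends s h -> depends t h ->
  avg mu s h x = avg mu t h y.
Proof.
move=> hs ht.
have cst u v : depends u h -> avg mu v (avg mu u h) = avg mu u h.
  by move=> hu; apply: avg_id => *; apply: avg_const.
by rewrite -(cst s t)// avgC cst//; apply: avg_const.
Qed.

Lemma avg_mul mu s t h k x : depends s h -> depends t k ->
  (forall i, i \in s -> i \in t -> False) ->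
  avg mu (s ++ t) (fun x => h x * k x) x = avg mu s h x * avg mu t k x.
Proof.
move=> hs ht st; rewrite avg_cat avg_pull; last first.
  move=> i b y it; apply: update_depends hs _.
  by apply/negP => /st; apply.
under eq_fun do rewrite mulrC (avg_const _ _ x ht).
by rewrite avgZ mulrC.
Qed.

Lemma avg1_cvg (mu : nat -> I -> R) (nu : I -> R) i (hn : nat -> config I -> R) h :
  (fun n => mu n i) @ \oo --> nu i ->
  (forall x, hn ^~ x @ \oo --> h x) ->
  forall x, (fun n => avg1 (mu n) i (hn n) x) @ \oo --> avg1 nu i h x.
Proof.
move=> mui hx x; rewrite /avg1; apply: cvgD; apply: cvgM => //.
by apply: cvgB => //; apply: cvg_cst.
Qed.

Lemma avg_cvg (mu : nat -> I -> R) (nu : I -> R) s h :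
  (forall i, (fun n => mu n i) @ \oo --> nu i) ->
  forall x, (fun n => avg (mu n) s h x) @ \oo --> avg nu s h x.
Proof.
move=> mui; elim: s => [|i s IH] x /=; first exact: cvg_cst.
exact: (avg1_cvg (mui i) IH).
Qed.

End averages.

(** * Measurability and uniqueness of measures on configurations *)

Section config_measurability.
Context (I : choiceType).

Lemma mbool_coord (i : I) : mbool (fun x : config I => x i).
Proof.
apply: set_mbool; apply: sub_sigma_algebra; exists i => //.
by exists [set true] => //; rewrite setTI.
Qed.

Lemma config_measurable d (T : measurableType d) (f : T -> config I) :
  (forall i, mbool (fun x => f x i)) -> measurable_fun setT f.
Proof.
move=> mf; apply: (@measurability _ _ _ _ setT f (\bigcup_i preimage_set_system setT
  (fun x : config I => x i) measurable)) => //.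
move=> _ [_ [i _ [B mB <-]] <-]; rewrite !setTI.
by rewrite -comp_preimage -(setTI (_ @^-1` _)); apply: mf.
Qed.

Lemma mbool_comp_config d (T : measurableType d) (f : T -> config I)
    (h : config I -> bool) :
  (forall i, mbool (fun x => f x i)) -> mbool h -> mbool (fun x => h (f x)).
Proof. by move=> /config_measurable mf mh; apply: measurableT_comp mh mf. Qed.

Lemma update_mbool (i : I) b : forall j, mbool (fun x => update i b x j).
Proof.
move=> j; rewrite /update; case: eqVneq => _; [exact: mbool_cst|].
exact: mbool_coord.
Qed.

(** Split according to the value of one coordinate after another. *)
Lemma depends_mbool s (h : config I -> bool) : depends s h -> mbool h.
Proof.
elim: s h => [|i s IH] h hs.
  rewrite (_ : h = fun=> h point); first exact: mbool_cst.
  by apply/funext => x; apply: hs.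
rewrite (_ : h = fun x => if x i then h (update i true x)
                          else h (update i false x)); last first.
  by apply/funext => x; case E: (x i); rewrite -E update_id.
have hb b : depends s (fun x => h (update i b x)) := depends_update b hs.
by apply: mbool_if; [exact: mbool_coord|exact: IH|exact: IH].
Qed.

Lemma depends_bm (R : realType) s (h : config I -> R) : depends s h -> bounded_mfun h.
Proof.
elim: s h => [|i s IH] h hs.
  rewrite (_ : h = fun=> h point); first exact: bm_cst.
  by apply/funext => x; apply: hs.
rewrite (_ : h = fun x => (x i)%:R * h (update i true x) +
                          (1 - (x i)%:R) * h (update i false x)); last first.
  by apply/funext => x; case E: (x i); rewrite -{1}(update_id i x) E /= ?mulr1n ?mulr0n; ring.
have hb b : depends s (fun x => h (update i b x)) := depends_update b hs.
have mi := @bm_mbool _ _ R _ (mbool_coord i).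
by apply: bmD; apply: bmM; try exact: IH; [|apply: bmB] => //; exact: bm_cst.
Qed.

Lemma bm_comp_config (R : realType) d (T : measurableType d) (f : T -> config I)
    (h : config I -> R) :
  (forall i, mbool (fun x => f x i)) -> bounded_mfun h -> bounded_mfun (fun x => h (f x)).
Proof.
move=> /config_measurable mf [mh [C hC]]; split; last by exists C.
exact: measurableT_comp mh mf.
Qed.

(** The events that all sites of a finite set are occupied form a pi-system that
    generates the product sigma-algebra. *)
Lemma config_measure_unique (R : realType)
    (m1 m2 : {measure set (config I) -> \bar R}) :
  (m1 setT < +oo)%E ->
  (forall s : seq I, uniq s ->
    m1 [set x | forall i, i \in s -> x i] = m2 [set x | forall i, i \in s -> x i]) ->
  forall A, measurable A -> m1 A = m2 A.
Proof.
move=> fin eqm A mA.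
pose C (s : seq I) := [set x : config I | forall i, i \in s -> x i].
have CT : C [::] = setT by apply/seteqP; split.
apply: (@measure_unique _ _ _ [set A | exists s, A = C s] (fun=> setT)) => //.
- apply/seteqP; split; last first.
    apply: smallest_sub; first exact: sigma_algebra_measurable.
    move=> _ [s ->]; have := @depends_mbool s (fun x : config I => all x s).
    have -> : C s = [set x : config I | all x s].
      by apply/seteqP; split => x /allP.
    move=> H; apply: mbool_set; apply: H.
    by apply: depends_all => i; apply: depends_coord.
  apply: smallest_sub; first exact: smallest_sigma_algebra.
  move=> _ [i _ [B mB <-]]; rewrite setTI.
  pose X := g_sigma_algebraType [set A | exists s, A = C s].
  have mi : mbool (fun x : X => (x : config I) i).
    apply: set_mbool; apply: sub_sigma_algebra; exists [:: i].
    apply/seteqP; split => x /=; first by move=> xi j; rewrite inE => /eqP->.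
    by apply; rewrite mem_head.
  by have := mi measurableT B mB; rewrite setTI.
- move=> _ _ [s ->] [t ->]; exists (s ++ t); apply/seteqP; split => x /=.
    by move=> [xs xt] i; rewrite mem_cat => /orP[]; [apply: xs|apply: xt].
  by move=> xst; split => i si; apply: xst; rewrite mem_cat si ?orbT.
- by move=> _; exists [::]; rewrite CT.
- by rewrite bigcup_const.
- move=> _ [s ->]; rewrite (_ : C s = C (undup s)); first exact/eqm/undup_uniq.
  by apply/seteqP; split => x xs i; have := xs i; rewrite mem_undup.
Qed.

End config_measurability.

(** * Expectations under the product measure *)

Section product_measure_averages.
Context (R : realType) (kappa : probability bool R) (I : choiceType).

Let p : R := fine (kappa [set true]).
Let P : probability (config I) R := product_measure kappa.
Local Notation E := (expect P).

Lemma kappa_trueE : kappa [set true] = p%:E.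
Proof. by rewrite fineK// fin_num_measure. Qed.

Lemma product_measure_ones (s : seq I) : uniq s ->
  P [set x | forall i, i \in s -> x i] = (p ^+ size s)%:E.
Proof.
move=> us; have := product_measureE kappa (fun=> [set true]) us.
rewrite big_const_seq count_predT kappa_trueE => H.
apply: (etrans H); elim: (size s) => [//|n IH].
by rewrite iterS IH exprS EFinM.
Qed.

Lemma product_measure_unique_ones (m : {measure set (config I) -> \bar R}) :
  (forall s : seq I, uniq s ->
    m [set x | forall i, i \in s -> x i] = (p ^+ size s)%:E) ->
  forall A, measurable A -> m A = P A.
Proof.
move=> mE A mA; apply/esym; apply: config_measure_unique => //.
  by rewrite ltey_eq fin_num_measure.
by move=> s us; rewrite mE; [exact: product_measure_ones|].
Qed.

Hypothesis p01 : 0 <= p <= 1.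

Lemma update_measurable (i : I) b : measurable_fun setT (update i b).
Proof. by apply: config_measurable; exact: update_mbool. Qed.

Definition updated i b : {measure set (config I) -> \bar R} :=
  measure_function_pushforward__canonical__measure_function_Measure
    P (update_measurable i b).

Definition mixture i (p0 : 0 <= p) (p1 : 0 <= 1 - p) :
    {measure set (config I) -> \bar R} :=
  measure_add (mscale (NngNum p0) (updated i true))
              (mscale (NngNum p1) (updated i false)).

Lemma mixtureE i (p0 : 0 <= p) (p1 : 0 <= 1 - p) A :
  mixture i p0 p1 A = (p%:E * P (update i true @^-1` A) +
                       (1 - p)%:E * P (update i false @^-1` A))%E.
Proof. exact: measure_addE. Qed.

(** Both sides are measures in [A], so it is enough to compare them on the events
    of [product_measure_unique_ones]. *)
Lemma resample_set i A : measurable A ->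
  P A = (p%:E * P (update i true @^-1` A) +
        (1 - p)%:E * P (update i false @^-1` A))%E.
Proof.
move=> mA.
have [p0 p1] : 0 <= p /\ 0 <= 1 - p by move/andP: p01 => [? ?]; split; lra.
pose m := mixture i p0 p1.
rewrite -(@product_measure_unique_ones m)//; first exact: mixtureE.
move=> s us; rewrite /m mixtureE.
have [si|si] := boolP (i \in s); last first.
  have H b : update i b @^-1` [set x | forall j, j \in s -> x j] =
      [set x | forall j, j \in s -> x j].
    apply/seteqP; split => x /= xs j js; have := xs j js; rewrite /update ifN//;
     by apply: contraNneq si => <-.
  rewrite !H product_measure_ones// -!EFinM -EFinD; congr EFin; ring.
have -> : update i true @^-1` [set x | forall j, j \in s -> x j] =
    [set x | forall j, j \in rem i s -> x j].
  apply/seteqP; split => x /= xs j.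
    rewrite mem_rem_uniq// inE => /andP[ji js].
    by have := xs j js; rewrite /update (negPf ji).
  move=> js; rewrite /update; case: eqVneq => // ji; apply: xs.
  by rewrite mem_rem_uniq// inE ji.
have -> : update i false @^-1` [set x | forall j, j \in s -> x j] = set0.
  apply/seteqP; split => x //= /(_ i si); by rewrite /update eqxx.
rewrite measure0 mule0 adde0 product_measure_ones ?rem_uniq//.
rewrite -EFinM size_rem// -exprS; congr (_ ^+ _)%:E.
by case: s si {us}.
Qed.

Lemma resample i f : bounded_mfun f -> E f = E (avg1 (fun=> p) i f).
Proof.
move=> bf; have [p0 p1] : 0 <= p /\ 0 <= 1 - p by move/andP: p01 => [? ?]; split; lra.
(* Adding a constant makes [f] nonnegative. *)
wlog f0 : f bf / forall x, 0 <= f x.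
  move=> W; have [mf [C fC]] := bf.
  have bC : bounded_mfun (fun x => f x + C) by apply: bmD => //; exact: bm_cst.
  have := W _ bC; rewrite expectD//; last exact: bm_cst.
  rewrite expect_cst => H.
  apply: (@addIr _ C); rewrite H; last first.
    by move=> x; have := fC x; rewrite ler_norml => /andP[]; lra.
  rewrite -{2}(expect_cst P C) -expectD//; last exact: bm_cst.
    by congr expect; apply/funext => x; rewrite /avg1; ring.
  by apply: bmD; apply: bmZ; apply: bm_comp_config => //; exact: update_mbool.
have bu b : bounded_mfun (fun x => f (update i b x)).
  by apply: bm_comp_config => //; exact: update_mbool.
pose m := mixture i p0 p1.
have mE : forall A, measurable A -> P A = m A.
  by move=> A mA; rewrite /m mixtureE; exact: resample_set.
apply: EFin_inj; rewrite EFin_expect// expectD; [|exact: bmZ..].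
rewrite !expectZ// EFinD !EFinM !EFin_expect//.
have mf : measurable_fun setT (EFin \o f) by apply/measurable_EFinP; case: bf.
transitivity (\int[m]_x (f x)%:E)%E.
  by apply: eq_measure_integral => A mA _; exact: mE.
have f0' : forall x, [set: config I] x -> (0 <= (f x)%:E)%E.
  by move=> x _; rewrite lee_fin.
rewrite /m /mixture ge0_integral_measure_add// !ge0_integral_mscale//=.
have pushE b : (\int[updated i b]_x (f x)%:E = \int[P]_x (f (update i b x))%:E)%E.
  apply: (ge0_integral_pushforward (update_measurable i b) P measurableT mf) => x _.
  by rewrite lee_fin.
by rewrite !pushE.
Qed.

(** For functions of finitely many coordinates, integrals under the product
    measure are finite sums. *)
Lemma expect_depends s f x : depends s f -> E f = avg (fun=> p) s f x.
Proof.
move=> fs; have bf := depends_bm fs.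
suff H t : bounded_mfun (avg (fun=> p) t f) /\ E f = E (avg (fun=> p) t f).
  rewrite (proj2 (H s)) -(expect_cst P (avg _ s f x)); congr expect.
  by apply/funext => y; apply: avg_const.
elim: t => //= i t [bt ->]; split; last exact: resample.
by apply: bmD; apply: bmZ; apply: bm_comp_config => //; exact: update_mbool.
Qed.

End product_measure_averages.

(** * First indices, and biased coins from fair bits *)

(** Where [f] is nowhere true a fixed value, here 0, keeps the choice
    equivariant. *)
Definition first_index (f : nat -> bool) : nat :=
  if pselect (exists i, f i) is left e then ex_minn e else 0%N.

Lemma firstP (f : nat -> bool) : (exists i, f i) -> f (first_index f).
Proof. by rewrite /first_index; case: pselect => // e _; case: ex_minnP. Qed.

Lemma first_min (f : nat -> bool) i : (i < first_index f)%N -> ~~ f i.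
Proof.
rewrite /first_index; case: pselect => // e; case: ex_minnP => n _ nmin.
by apply: contraL => /nmin; rewrite leqNgt.
Qed.

Lemma mbool_first d (T : measurableType d) (f : T -> nat -> bool) n :
  (forall i, mbool (f ^~ i)) -> mbool (fun x => first_index (f x) == n).
Proof.
move=> mf; rewrite (_ : (fun x => _) = (fun x =>
  (f x n && all (fun i => ~~ f x i) (iota 0 n)) ||
  ((n == 0%N) && `[< forall i, ~~ f x i >]))).
  apply: mboolU; apply: mboolI => //; try exact: mbool_cst.
    by apply: (mbool_all (iota 0 n) (f := fun i x => ~~ f x i)) => i; exact: mboolN.
  by apply: (mbool_forall (f := fun i x => ~~ f x i)) => i; exact: mboolN.
apply/funext => x; apply/eqP/idP.
  move=> <-; have [ex|nex] := pselect (exists i, f x i).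
    rewrite firstP//=; apply/orP; left; apply/allP => i.
    by rewrite mem_iota add0n => /first_min.
  have -> : first_index (f x) = 0%N by rewrite /first_index; case: pselect.
  apply/orP; right; rewrite eqxx.
  by apply/asboolP => i; apply/negP => fi; apply: nex; exists i.
move=> /orP[/andP[fn /allP no]|/andP[/eqP-> /asboolP no]].
  have ex : exists i, f x i by exists n.
  case: (ltngtP (first_index (f x)) n) => // [lt|/first_min]; last by rewrite fn.
  have := no (first_index (f x)).
  by rewrite mem_iota lt firstP// => /(_ isT).
rewrite /first_index; case: pselect => // e; exfalso.
by case: e => i; apply/negP.
Qed.

(** Every site [g] owns a doubly indexed family of fair bits: the first index is
    the kind of coin, the second one the position in its sequence of bits. *)
Definition bit_index (G : groupType) := (G * (nat * nat))%type.

Section coin.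
Context (R : realType).

(** A coin of bias [rho] is tossed with fair bits: one value of the first bit
    decides the outcome, the other one leaves a coin of bias 2 rho - 1 or 2 rho to
    be tossed with the remaining bits. A coin undecided after [n] bits counts as
    false, which makes it increase with [n]. *)
Fixpoint coin n (rho : R) (c : nat -> bool) : bool :=
  if n is n'.+1 then
    if 1 / 2 <= rho then c 0%N || coin n' (2 * rho - 1) (fun l => c l.+1)
    else ~~ c 0%N && coin n' (2 * rho) (fun l => c l.+1)
  else false.

Fixpoint coin_mean n (rho : R) : R :=
  if n is n'.+1 then
    if 1 / 2 <= rho then 1 / 2 + 1 / 2 * coin_mean n' (2 * rho - 1)
    else 1 / 2 * coin_mean n' (2 * rho)
  else 0.

Lemma coinS n rho c : coin n rho c -> coin n.+1 rho c.
Proof.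
elim: n rho c => [//|n IH] rho c; rewrite [coin n.+2 _ _]/= [coin n.+1 _ _]/=.
case: ifP => _; first by move=> /orP[->//|/IH]; rewrite /= => ->; rewrite orbT.
by move=> /andP[-> /IH].
Qed.

Lemma coin_le n k rho c : (n <= k)%N -> coin n rho c -> coin k rho c.
Proof. by move=> /subnK <-; elim: (k - n)%N => // i IH /IH /coinS. Qed.

Lemma coin_mean_error n rho : 0 <= rho <= 1 -> `|rho - coin_mean n rho| <= (1 / 2) ^+ n.
Proof.
elim: n rho => [|n IH] rho r01 /=.
  by rewrite subr0 expr0 ger0_norm; lra.
case: ifP => r2.
  have -> : rho - (1 / 2 + 1 / 2 * coin_mean n (2 * rho - 1)) =
            1 / 2 * ((2 * rho - 1) - coin_mean n (2 * rho - 1)) by lra.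
  rewrite normrM exprS ger0_norm ?ler_pM2l//; try lra.
  by apply: IH; lra.
have -> : rho - 1 / 2 * coin_mean n (2 * rho) =
          1 / 2 * (2 * rho - coin_mean n (2 * rho)) by lra.
rewrite normrM exprS ger0_norm ?ler_pM2l//; try lra.
by apply: IH; move/negbT: r2; rewrite -ltNge; lra.
Qed.

Lemma coin_mean_cvg rho : 0 <= rho <= 1 -> (fun n => coin_mean n rho) @ \oo --> rho.
Proof.
move=> r01; apply: cvg_zero => /=.
apply/norm_cvg0P.
have H : (fun n => (1 / 2 : R) ^+ n) @ \oo --> (0 : R).
  by apply: cvg_expr; rewrite ger0_norm; lra.
apply: (squeeze_cvgr _ (cvg_cst 0) H).
apply: nearW => n; rewrite normr_ge0 /= distrC.
exact: coin_mean_error.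
Qed.

Lemma mbool_coin d (T : measurableType d) n rho (c : T -> nat -> bool) :
  (forall l, mbool (c ^~ l)) -> mbool (fun x => coin n rho (c x)).
Proof.
elim: n rho c => [|n IH] rho c mc /=; first exact: mbool_cst.
case: (1 / 2 <= rho).
  by apply: mboolU; [exact: mc|apply: (IH _ (fun x l => c x l.+1)) => l; exact: mc].
by apply: mboolI; [exact/mboolN/mc|apply: (IH _ (fun x l => c x l.+1)) => l; exact: mc].
Qed.

Lemma avg_coin (W : choiceType) (e : nat -> W) n rho j z : injective e ->
  avg (fun=> 1 / 2) [seq e l | l <- iota j n]
    (fun c => (coin n rho (fun l => c (e (j + l)%N)))%:R) z = coin_mean n rho.
Proof.
move=> einj; elim: n rho j z => [//|n IH] rho j z.
rewrite [LHS]/= -/(avg _ _ _).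
pose F rho' : config W -> R := fun c => (coin n rho' (fun l => c (e (j.+1 + l)%N)))%:R.
have shift rho' (c : config W) : coin n rho' (fun l => c (e (j + l.+1)%N)) =
    coin n rho' (fun l => c (e (j.+1 + l)%N)).
  by congr coin; apply/funext => l; rewrite addnS.
have fresh b u (c : config W) : u \in [seq e l | l <- iota j.+1 n] ->
    update u b c (e j) = c (e j).
  move=> /mapP[l]; rewrite mem_iota => lj ->; rewrite /update ifN//.
  by rewrite (inj_eq einj); lia.
rewrite [RHS]/=; case: (1 / 2 <= rho).
  have -> : (fun c : config W => (c (e (j + 0)%N) ||
        coin n (2 * rho - 1) (fun l => c (e (j + l.+1)%N)))%:R : R) =
      fun c => (c (e j))%:R + (1 - (c (e j))%:R) * F (2 * rho - 1) c.
    apply/funext => c; rewrite shift addn0 /F.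
    by case: (c (e j)); rewrite /= ?mulr1n ?mulr0n; ring.
  rewrite avgD avg_id; last by move=> u b c us; rewrite fresh.
  rewrite avg_pull; last by move=> u b c us; rewrite fresh.
  by rewrite /avg1 /F !IH /update eqxx /= ?mulr1n ?mulr0n; field.
have -> : (fun c : config W => (~~ c (e (j + 0)%N) &&
      coin n (2 * rho) (fun l => c (e (j + l.+1)%N)))%:R : R) =
    fun c => (1 - (c (e j))%:R) * F (2 * rho) c.
  apply/funext => c; rewrite shift addn0 /F.
  by case: (c (e j)); rewrite /= ?mulr1n ?mulr0n; ring.
rewrite avg_pull; last by move=> u b c us; rewrite fresh.
by rewrite /avg1 /F !IH /update eqxx /= ?mulr1n ?mulr0n; field.
Qed.

End coin.

Section coins.
Context (R : realType) (G : groupType) (mu : G * nat -> R).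
Local Notation var := (G * nat)%type.
Implicit Types (v : var) (c : config (bit_index G)).

Definition coin_bits n v : seq (bit_index G) := [seq (v.1, (v.2, l)) | l <- iota 0 n].

Definition coins n c : config var := fun v => coin n (mu v) (fun l => c (v.1, (v.2, l))).

Lemma coins_update n v w u b c : u \in coin_bits n v -> w != v ->
  coins n (update u b c) w = coins n c w.
Proof.
move=> /mapP[l _ ->] wv; rewrite /coins; congr coin; apply/funext => l'.
rewrite /update ifN//; apply: contraNneq wv => -[w1 w2 _].
by case: w v w1 w2 => [? ?] [? ?] /= -> ->.
Qed.

(** Different coins read disjoint families of bits, so finitely many of them are
    independent, each with its own mean. *)
Lemma avg_coins n (S : seq var) (k : config var -> R) c :
  avg (fun=> 1 / 2) (flatten [seq coin_bits n v | v <- S]) (fun c => k (coins n c)) c =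
  avg (fun v => coin_mean n (mu v)) S k (coins n c).
Proof.
elim: S k c => [//|v S IH] k c.
rewrite [flatten _]/= avg_cat avgC.
have -> : avg (fun=> 1 / 2) (coin_bits n v) (fun c => k (coins n c)) =
    fun c => avg1 (fun v => coin_mean n (mu v)) v k (coins n c).
  have -> : (fun c => k (coins n c)) = fun c =>
      k (update v true (coins n c)) * (coins n c v)%:R +
      k (update v false (coins n c)) * (1 - (coins n c v)%:R).
    apply/funext => c'; rewrite -{1}(update_id v (coins n c')).
    by case: (coins n c' v); rewrite /= ?mulr1n ?mulr0n; ring.
  have fresh b b' u c' : u \in coin_bits n v ->
      k (update v b (coins n (update u b' c'))) = k (update v b (coins n c')).
    move=> us; congr k; apply/funext => w; rewrite {1 3}/update.
    by case: eqVneq => // wv; rewrite (coins_update _ _ us).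
  apply/funext => c'; rewrite avgD !avg_pull; try by move=> *; rewrite fresh.
  rewrite avgB avg_cst.
  have -> : avg (fun=> 1 / 2) (coin_bits n v) (fun c => (coins n c v)%:R) c' =
      coin_mean n (mu v).
    by apply: (avg_coin (e := fun l => (v.1, (v.2, l)))) => l l' [].
  by rewrite /avg1; ring.
by rewrite IH /= avg1_avgC.
Qed.

Lemma coins_depends n (S : seq var) (T : Type) (k : config var -> T) : depends S k ->
  depends (flatten [seq coin_bits n v | v <- S]) (fun c => k (coins n c)).
Proof.
move=> kS c c' cc; apply: kS => v vS; rewrite /coins.
suff H m (r : R) j : (j + m <= n)%N ->
    coin m r (fun l => c (v.1, (v.2, (j + l)%N))) =
    coin m r (fun l => c' (v.1, (v.2, (j + l)%N))).
  exact: (H n (mu v) 0%N).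
elim: m r j => //= m IH r j jm.
have E (d : config (bit_index G)) : (fun l => d (v.1, (v.2, (j + l.+1)%N))) =
    fun l => d (v.1, (v.2, (j.+1 + l)%N)) by apply/funext => l; rewrite addnS.
rewrite !E !IH; [|by rewrite addSnnS..].
rewrite cc//; apply/flattenP; exists (coin_bits n v); first exact: map_f.
by apply: map_f; rewrite mem_iota; lia.
Qed.

End coins.

(** * Non-overlapping patterns on a-lines *)

Section construction.
Context (G : groupType) (gens : set G) (S_basis : free_basis gens) (a a' : G).
Hypotheses (Sa : gens a) (Sa' : gens a') (aa' : a != a').
Context (m : nat).
Implicit Types (g h : G) (x y : config G) (z : config (G * nat)%type) (Q : pred G).
Local Notation var := (G * nat)%type.

Let a_inj i j : (a ^+ i = a ^+ j)%g -> i = j.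
Proof. exact: free_expg_inj S_basis Sa. Qed.

Definition site h i : G := (h * a ^+ i)%g.

(** The marker 1^(m+3) 0 v 0 starting at [h], where v occupies the [slot] and is
    not constrained. The first two sites of the slot are [pair_site true h] and
    [pair_site false h]; the remaining ones are [rest_sites h]. *)
Definition occ x h : bool :=
  [&& all (fun i => x (site h i)) (iota 0 (m + 3)),
      ~~ x (site h (m + 3)) & ~~ x (site h (m + 6 + m))].

Definition pair_site (e : bool) h : G := site h (m + 4 + ~~ e).

Definition rest_sites h : seq G := [seq site h i | i <- iota (m + 6) m].

Definition slot h : seq G := [seq site h i | i <- iota (m + 4) (m + 2)].

Definition base x h : bool := occ x h && all (fun g => ~~ x g) (rest_sites h).

(** The special occurrences, whose free word is 10 0^m or 01 0^m; the order of
    the two letters is the hidden bit. *)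
Definition special x h : bool :=
  base x h && (x (pair_site true h) (+) x (pair_site false h)).

Lemma site_add h i j : site (site h i) j = site h (i + j).
Proof. by rewrite /site -mulgA expgnDr. Qed.

Lemma site_inj h i j : site h i = site h j -> i = j.
Proof. by move=> /mulgI /a_inj. Qed.

Lemma site_eq_shift h h' i j : site h i = site h' j -> (i <= j)%N ->
  h = site h' (j - i).
Proof.
move=> hh ij; apply: (@mulIg _ (a ^+ i)%g).
by rewrite -[LHS]/(site h i) -[RHS]/(site _ i) site_add subnK.
Qed.

Lemma occ_ones x h i : occ x h -> (i < m + 3)%N -> x (site h i).
Proof. by move=> /and3P[/allP xs _ _] im; apply: xs; rewrite mem_iota. Qed.

(** Shift the pattern by s with 0 < s <= 2 m + 6. If s <= m + 3, the initial run
    of ones of the shifted pattern covers the 0 that follows the initial run. If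
    s > m + 3, it covers the final 0, because the run is longer than the
    slot. The two letters compared are both prescribed, so the content of the
    slots does not matter. *)
Lemma occ_nonoverlap x h h' i j : occ x h -> occ x h' ->
  site h i = site h' j -> (i <= m + 6 + m)%N -> (j <= m + 6 + m)%N -> h = h'.
Proof.
wlog ij : h h' i j / (i <= j)%N.
  move=> W; have [ij|/ltnW ji] := leqP i j; first exact: W.
  by move=> oh oh' /esym e lei lej; apply/esym; apply: W e _ _.
move=> oh oh' /site_eq_shift /(_ ij) hE lei lej.
move: hE; set s := (j - i)%N; have [->|s0] := posnP s.
  by rewrite /site expg0 mulg1.
move=> hE; exfalso; have [/and3P[_ /negP z1 /negP z2]] := (oh').
have [sm|sm] := leqP s (m + 3)%N.
  apply: z1; have := occ_ones (i := m + 3 - s) oh.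
  by rewrite hE site_add subnKC//; apply; lia.
apply: z2; have := occ_ones (i := m + 6 + m - s) oh.
by rewrite hE site_add subnKC; [apply; lia|lia].
Qed.

Lemma mem_slot h i : (m + 4 <= i < m + 6 + m)%N -> site h i \in slot h.
Proof. by move=> im; apply: map_f; rewrite mem_iota; lia. Qed.

Lemma slotP h g : g \in slot h ->
  exists2 i, (m + 4 <= i < m + 6 + m)%N & g = site h i.
Proof. by move=> /mapP[i]; rewrite mem_iota => im ->; exists i => //; lia. Qed.

Lemma rest_sitesP h g : g \in rest_sites h ->
  exists2 i, (m + 6 <= i < m + 6 + m)%N & g = site h i.
Proof. by move=> /mapP[i]; rewrite mem_iota => im ->; exists i => //; lia. Qed.

Lemma rest_slot h g : g \in rest_sites h -> g \in slot h.
Proof. by move=> /rest_sitesP[i im ->]; apply: mem_slot; lia. Qed.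

Lemma pair_slot e h : pair_site e h \in slot h.
Proof. by apply: mem_slot; case: e => /=; lia. Qed.

Lemma fixed_not_slot h i : (i < m + 4)%N || (m + 6 + m <= i)%N ->
  site h i \notin slot h.
Proof. by move=> im; apply/negP => /slotP[j jm /site_inj ?]; lia. Qed.

Lemma pair_not_rest e h : pair_site e h \notin rest_sites h.
Proof.
by apply/negP => /rest_sitesP[i im /site_inj]; case: e => /=; lia.
Qed.

Lemma pair_site_inj e e' h : pair_site e h = pair_site e' h -> e = e'.
Proof. by move=> /site_inj; case: e; case: e' => //=; lia. Qed.

(** By [occ_nonoverlap], replacing the content of the slot of an occurrence
    neither creates nor destroys occurrences: this is the sense in which the free
    words are independent of their positions. The lemmas below say what is left
    unchanged by such a replacement. *)
Definition agree_off h x y := forall g, g \notin slot h -> x g = y g.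

Lemma agree_off_sym h x y : agree_off h x y -> agree_off h y x.
Proof. by move=> xy g /xy. Qed.

Lemma agree_occ h x y : agree_off h x y -> occ x h = occ y h.
Proof.
move=> xy; rewrite /occ !(xy (site h (m + _))) ?xy ?fixed_not_slot ?ltn_add2l ?leqnn ?orbT//.
congr (_ && _); apply: eq_in_all => i; rewrite mem_iota => im.
by rewrite xy// fixed_not_slot//; apply/orP; left; lia.
Qed.

Lemma occ_site_not_slot x h h' i : occ x h -> occ x h' -> h' != h ->
  (i <= m + 6 + m)%N -> site h' i \notin slot h.
Proof.
move=> oh oh' /eqP hh' im; apply/negP => /slotP[j jm e]; apply: hh'.
by apply: occ_nonoverlap oh' oh e _ _ => //; lia.
Qed.

Lemma occ_slot_not_slot x h h' g : occ x h -> occ x h' -> h' != h ->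
  g \in slot h' -> g \notin slot h.
Proof.
by move=> oh oh' hh' /slotP[i im ->]; apply: occ_site_not_slot oh oh' hh' _; lia.
Qed.

Lemma agree_occ_imp h h' x y : agree_off h x y -> occ x h -> h' != h ->
  occ x h' -> occ y h'.
Proof.
move=> xy oh hh' oh'.
have E i : (i <= m + 6 + m)%N -> y (site h' i) = x (site h' i).
  by move=> im; apply/esym/xy; apply: occ_site_not_slot oh oh' hh' im.
rewrite /occ !E; [|lia..]; case/and3P: oh' => o1 -> ->; rewrite !andbT.
by apply/allP => i im; rewrite E; [apply: (allP o1)|move: im; rewrite mem_iota; lia].
Qed.

Lemma agree_occ_other h h' x y : agree_off h x y -> occ x h -> h' != h ->
  occ x h' = occ y h'.
Proof.
move=> xy oh hh'; apply/idP/idP; first exact: agree_occ_imp xy oh hh'.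
by apply: agree_occ_imp (agree_off_sym xy) _ hh'; rewrite -(agree_occ xy).
Qed.

Lemma agree_base_other h h' x y : agree_off h x y -> occ x h -> h' != h ->
  base x h' = base y h'.
Proof.
move=> xy oh hh'; rewrite /base -(agree_occ_other xy oh hh').
case oh' : (occ x h') => //=; apply: eq_in_all => g /rest_slot gs.
by rewrite xy//; apply: occ_slot_not_slot oh oh' hh' gs.
Qed.

Lemma agree_special_other h h' x y : agree_off h x y -> occ x h -> h' != h ->
  special x h' = special y h'.
Proof.
move=> xy oh hh'; rewrite /special -(agree_base_other xy oh hh').
case bh' : (base x h') => //=; have /andP[oh' _] := bh'.
by rewrite !xy//; apply: occ_slot_not_slot oh oh' hh' (pair_slot _ _).
Qed.

(** * The modified thinning *)

(** A configuration on G * nat stacks the input and the coins: layer 0 is the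
    input, layer 1 the coin of the plain thinning, and layers 2 and 3 the coins
    used by the compensation at an occurrence, the latter choosing one of the two
    sites. *)
Definition input z : config G := fun g => z (g, 0%N).

Definition plain z g : bool := z (g, 0%N) && z (g, 1%N).

Definition compensated z h : bool :=
  [&& occ (input z) h, z (pair_site true h, 0%N), z (pair_site false h, 0%N),
      ~~ z (pair_site true h, 1%N), ~~ z (pair_site false h, 1%N),
      all (fun g => ~~ plain z g) (rest_sites h) & z (h, 2%N)].

(** The start of the only pattern that could have [g] as its site
    [pair_site e]. *)
Definition owner (e : bool) g : G := (g * (a ^+ (m + 4 + ~~ e))^-1)%g.

(** The modification is performed only at the occurrences in [Q]. In this way
    it can be switched on for one occurrence at a time; [Q] is [predT] in the construction and
    [pred0] gives the plain thinning. *)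
Definition thin Q z g : bool :=
  if has (fun e => Q (owner e g) && special (input z) (owner e g)) [:: true; false]
  then false
  else if has (fun e => [&& Q (owner e g), compensated z (owner e g) &
                        z (owner e g, 3%N) == e]) [:: true; false]
  then true else plain z g.

Lemma ownerK e g : pair_site e (owner e g) = g.
Proof. exact: mulgVK. Qed.

Lemma pair_siteK e h : owner e (pair_site e h) = h.
Proof. exact: mulgK. Qed.

Lemma special_occ x h : special x h -> occ x h.
Proof. by case/andP => /andP[]. Qed.

Lemma compensated_occ z h : compensated z h -> occ (input z) h.
Proof. by case/andP. Qed.

(** Otherwise the two patterns would overlap and hence coincide, but the two sites
    of a pair are different. *)
Lemma owner_other z e h : occ (input z) h ->
  ~~ occ (input z) (owner (~~ e) (pair_site e h)).
Proof.
move=> oh; apply/negP => oh'.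
have E := ownerK (~~ e) (pair_site e h).
have H : owner (~~ e) (pair_site e h) = h.
  by apply: occ_nonoverlap oh' oh E _ _; case: (e) => /=; lia.
by rewrite H in E; have := pair_site_inj E; case: (e).
Qed.

Lemma has_bool (f : bool -> bool) e : has f [:: true; false] = f e || f (~~ e).
Proof. by case: e; rewrite /= orbF // orbC. Qed.

Lemma thin_pair_site Q z e h : occ (input z) h ->
  thin Q z (pair_site e h) =
  if Q h && special (input z) h then false
  else if [&& Q h, compensated z h & z (h, 3%N) == e] then true
  else plain z (pair_site e h).
Proof.
move=> oh; have no := owner_other e oh.
rewrite /thin !(has_bool _ e) !pair_siteK.
rewrite (contraNF (@special_occ _ _) no) (contraNF (@compensated_occ _ _) no).
by rewrite !(andbF, andFb, orbF).
Qed.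

Lemma thin_eq Q Q' z g :
  (forall e, occ (input z) (owner e g) -> Q (owner e g) = Q' (owner e g)) ->
  thin Q z g = thin Q' z g.
Proof.
move=> QQ; have H e : (Q (owner e g) && special (input z) (owner e g) =
    Q' (owner e g) && special (input z) (owner e g)) /\
   ([&& Q (owner e g), compensated z (owner e g) & z (owner e g, 3%N) == e] =
    [&& Q' (owner e g), compensated z (owner e g) & z (owner e g, 3%N) == e]).
  case: (boolP (occ (input z) (owner e g))) => [/QQ->//|no].
  rewrite (contraNF (@special_occ _ _) no) (contraNF (@compensated_occ _ _) no).
  by rewrite !andbF.
by rewrite /thin /= !(H true).1 !(H false).1 !(H true).2 !(H false).2.
Qed.

Lemma thin_le Q z g : thin Q z g -> input z g.
Proof.
rewrite /thin; case: ifP => // _; case: ifP => [|_ /andP[]//].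
rewrite /= orbF => /orP[] /and3P[_ /and3P[_ x1 /andP[x2 _]] _] _.
  by move: x1; rewrite ownerK.
by move: x2; rewrite ownerK.
Qed.

Definition window h : seq var :=
  [seq (site h i, 0%N) | i <- iota 0 (m + 7 + m)] ++
  [seq (site h i, 1%N) | i <- iota 0 (m + 7 + m)] ++ [:: (h, 2%N); (h, 3%N)].

Definition thin_support g : seq var :=
  [:: (g, 0%N); (g, 1%N)] ++ window (owner true g) ++ window (owner false g).

Lemma window_site h i k : (i <= m + 6 + m)%N -> (k < 2)%N -> (site h i, k) \in window h.
Proof.
move=> im; rewrite !mem_cat; case: k => [_|[_|//]].
  by rewrite (map_f (fun i => (site h i, 0%N)))// mem_iota; lia.
by rewrite (map_f (fun i => (site h i, 1%N))) ?orbT// mem_iota; lia.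
Qed.

Lemma window_coin h k : (2 <= k < 4)%N -> (h, k) \in window h.
Proof. by case: k => [|[|[|[|//]]]] // _; rewrite !mem_cat !inE eqxx ?orbT. Qed.

Lemma occ_depends h : depends (window h) (fun z => occ (input z) h).
Proof.
move=> z z' zz; rewrite /occ /input !zz; [|by apply: window_site; lia..].
congr (_ && _); apply: eq_in_all => i; rewrite mem_iota => im.
by rewrite zz//; apply: window_site; lia.
Qed.

Lemma slot_window h g k : g \in slot h -> (k < 2)%N -> (g, k) \in window h.
Proof. by move=> /slotP[i im ->] k2; apply: window_site; lia. Qed.

Lemma special_depends h : depends (window h) (fun z => special (input z) h).
Proof.
move=> z z' zz; rewrite /special /base (occ_depends zz) /input.
rewrite !zz; [|by apply: slot_window => //; exact: pair_slot..].
congr (_ && _ && _); apply: eq_in_all => g /rest_slot gs.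
by rewrite zz//; apply: slot_window.
Qed.

Lemma compensated_depends h : depends (window h) (fun z => compensated z h).
Proof.
move=> z z' zz; rewrite /compensated (occ_depends zz).
rewrite !zz; [|by apply: window_coin|by apply: slot_window => //; exact: pair_slot..].
do 5 congr (_ && _); congr (_ && _); apply: eq_in_all => g /rest_slot gs.
by rewrite /plain !zz//; apply: slot_window.
Qed.

Lemma thin_depends Q g : depends (thin_support g) (fun z => thin Q z g).
Proof.
move=> z z' zz; have zw e v : v \in window (owner e g) -> z v = z' v.
  by move=> vw; apply: zz; rewrite 2!mem_cat; case: e vw => ->; rewrite ?orbT.
rewrite /thin /= !(special_depends (zw _)) !(compensated_depends (zw _)).
rewrite !(zw _ _ (window_coin _ _))// /plain !zz// !mem_cat !inE !eqxx ?orbT//.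
Qed.

(** All the randomness that is private to the occurrence at [h]; resampling it is
    what proves that switching on the modification at [h] preserves the law. *)
Definition slot_vars h : seq var :=
  [seq (g, 0%N) | g <- slot h] ++ [seq (g, 1%N) | g <- slot h] ++
  [:: (h, 2%N); (h, 3%N)].

Definition agree_vars h z z' := forall v, v \notin slot_vars h -> z v = z' v.

Lemma slot_varsP h g k : ((g, k) \in slot_vars h) =
  (g \in slot h) && (k < 2)%N || (g == h) && (2 <= k < 4)%N.
Proof.
have inj l : injective (fun g : G => (g, l : nat)) by move=> u v [].
have no (l k' : nat) : l != k' -> ((g, k') \in [seq (u, l) | u <- slot h]) = false.
  by move=> lk; apply/negbTE/negP => /mapP[u _ [_ e]]; rewrite e eqxx in lk.
rewrite !mem_cat !inE !xpair_eqE; case: k => [|[|k]].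
- by rewrite (mem_map (inj 0%N)) no// !andbF !andbT !orbF.
- by rewrite (mem_map (inj 1%N)) no// !andbF !andbT !orbF.
- by rewrite !no//; case: (g == h) => //=; case: k => [|[|k]]; rewrite ?andbF.
Qed.

Lemma agree_input h z z' : agree_vars h z z' -> agree_off h (input z) (input z').
Proof. by move=> zz g gs; apply: zz; rewrite slot_varsP (negPf gs) andbF. Qed.

Lemma agree_plain h z z' g : agree_vars h z z' -> g \notin slot h ->
  plain z g = plain z' g.
Proof.
by move=> zz gs; rewrite /plain !zz// slot_varsP (negPf gs) andbF.
Qed.

Lemma agree_coin h h' k z z' : agree_vars h z z' -> h' != h -> (2 <= k)%N ->
  z (h', k) = z' (h', k).
Proof.
move=> zz hh k2; apply: zz; rewrite slot_varsP (negPf hh) /=.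
by rewrite ltnNge k2 andbF.
Qed.

Lemma agree_compensated h h' z z' : agree_vars h z z' -> occ (input z) h ->
  h' != h -> compensated z h' = compensated z' h'.
Proof.
move=> zz oh hh; rewrite /compensated -(agree_occ_other (agree_input zz) oh hh).
case oh' : (occ (input z) h') => //=.
have sl g : g \in slot h' -> g \notin slot h by apply: occ_slot_not_slot oh oh' hh.
have E e k : (k < 2)%N -> z (pair_site e h', k) = z' (pair_site e h', k).
  move=> k2; apply: zz; rewrite slot_varsP (negPf (sl _ (pair_slot _ _))) /=.
  by case: k k2 => [|[|]] // _; rewrite andbF.
rewrite !E// (agree_coin zz hh)//.
do 4 congr (_ && _); congr (_ && _); apply: eq_in_all => g /rest_slot /sl gs.
by rewrite (agree_plain zz).
Qed.

Lemma agree_thin Q h z z' g : agree_vars h z z' -> occ (input z) h -> ~~ Q h ->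
  g \notin slot h -> thin Q z g = thin Q z' g.
Proof.
move=> zz oh Qh gs; rewrite /thin (agree_plain zz)//.
have S e : Q (owner e g) && special (input z) (owner e g) =
           Q (owner e g) && special (input z') (owner e g).
  have [->|hh] := eqVneq (owner e g) h; first by rewrite (negPf Qh).
  by rewrite (agree_special_other (agree_input zz) oh).
have C e : [&& Q (owner e g), compensated z (owner e g) & z (owner e g, 3%N) == e] =
           [&& Q (owner e g), compensated z' (owner e g) & z' (owner e g, 3%N) == e].
  have [->|hh] := eqVneq (owner e g) h; first by rewrite (negPf Qh).
  by rewrite (agree_compensated zz oh)// (agree_coin zz).
by rewrite /= !S !C.
Qed.

Lemma agree_update v b h z : v \in slot_vars h -> agree_vars h z (update v b z).
Proof.
move=> vs u us; rewrite /update ifN//.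
by apply: contraNneq us => ->.
Qed.

Lemma thin_rest Q z h g : occ (input z) h -> g \in rest_sites h ->
  thin Q z g = plain z g.
Proof.
move=> oh gr; have no e : ~~ occ (input z) (owner e g).
  have [i im gE] := rest_sitesP gr; apply/negP => oh'.
  have E := ownerK e g; have H : owner e g = h.
    rewrite gE in E oh' *.
    by apply: (occ_nonoverlap oh' oh E _ _); case: (e) => /=; lia.
  by have := pair_not_rest e h; rewrite -{1}H E gr.
rewrite (@thin_eq Q pred0) /thin //= => e.
by rewrite (negPf (no e)).
Qed.

(** Within the slot of an occurrence, the modification at [h] removes the letter
    at [pair_site e h] on the event [loss] and adds it on the event [gain]
    ([thin_gain_loss]). *)
Definition loss e h z : bool :=
  [&& z (pair_site e h, 0%N), z (pair_site e h, 1%N), ~~ z (pair_site (~~ e) h, 0%N)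
    & all (fun g => ~~ z (g, 0%N)) (rest_sites h)].

Definition gain e h z : bool :=
  [&& z (pair_site true h, 0%N), z (pair_site false h, 0%N),
      ~~ z (pair_site true h, 1%N), ~~ z (pair_site false h, 1%N),
      all (fun g => ~~ plain z g) (rest_sites h), z (h, 2%N) & z (h, 3%N) == e].

(** * Exchanging the two letters of a special occurrence *)

Definition combine x c : config (G * nat)%type :=
  fun v => if v.2 == 0%N then x v.1 else c v.

(** The condition [base x h] does not involve the two letters exchanged, which
    makes the exchange measure preserving; it changes [x] only if [h] is
    special. *)
Definition swap h x : config G :=
  if base x h then
    fun g => if g == pair_site true h then x (pair_site false h)
             else if g == pair_site false h then x (pair_site true h) else x g
  else x.

Lemma pair_site_TF h : (pair_site false h == pair_site true h) = false.
Proof. by apply/eqP => /(pair_site_inj). Qed.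

Lemma swap_pair h x e : base x h -> swap h x (pair_site e h) = x (pair_site (~~ e) h).
Proof.
by rewrite /swap => ->; case: e; rewrite /= ?eqxx ?pair_site_TF.
Qed.

Lemma swap_agree h x : agree_off h x (swap h x).
Proof.
move=> g gs; rewrite /swap; case: ifP => // _.
rewrite !ifN//; apply: contraNneq gs => ->; exact: pair_slot.
Qed.

Lemma swap_not_base h x : ~~ base x h -> swap h x = x.
Proof. by rewrite /swap => /negPf ->. Qed.

Lemma swap_rest h x g : g \in rest_sites h -> swap h x g = x g.
Proof.
move=> gr; rewrite /swap; case: ifP => // _.
by rewrite !ifN//; apply: contraTneq gr => ->; apply: pair_not_rest.
Qed.

Lemma swap_base h x h' : base (swap h x) h' = base x h'.
Proof.
have [bh|/swap_not_base->//] := boolP (base x h).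
have oh : occ x h by case/andP: bh.
have [->|hh] := eqVneq h' h.
  rewrite /base -(agree_occ (swap_agree (h := h) x)); congr (_ && _).
  by apply: eq_in_all => g /swap_rest ->.
by rewrite (agree_base_other (swap_agree (h := h) x) oh hh).
Qed.

Lemma swap_special h x h' : special (swap h x) h' = special x h'.
Proof.
have [bh|/swap_not_base->//] := boolP (base x h).
have oh : occ x h by case/andP: bh.
have [->|hh] := eqVneq h' h.
  by rewrite /special swap_base !swap_pair//= addbC.
by rewrite (agree_special_other (swap_agree (h := h) x) oh hh).
Qed.

Lemma swap_not_special h x : ~~ special x h -> swap h x = x.
Proof.
have [bh|/swap_not_base->//] := boolP (base x h).
rewrite /special bh /= => /negPf xx; apply/funext => g; rewrite /swap bh.
have {xx}xx : x (pair_site false h) = x (pair_site true h).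
  by move: xx; case: (x _); case: (x _).
by case: eqVneq => [->//|_]; case: eqVneq => [->|].
Qed.

Lemma swap_bit h x k : special x h ->
  special x k && swap h x (pair_site true k) =
  (special x k && x (pair_site true k)) (+) (k == h).
Proof.
move=> sh; have bh : base x h by case/andP: sh.
have oh : occ x h by case/andP: bh.
have [->|kh] := eqVneq k h.
  rewrite sh /= swap_pair//=; move: sh; rewrite /special bh /=.
  by case: (x _); case: (x _).
rewrite addbF; case sk : (special x k) => //=.
rewrite (swap_agree (h := h) x)//.
by apply: (occ_slot_not_slot oh (special_occ sk) kh (pair_slot _ _)).
Qed.

(** The output does not reveal the hidden bits: both letters of a special
    occurrence are erased, and nothing else depends on their order. *)
Lemma swap_thin h x c g : thin predT (combine (swap h x) c) g = thin predT (combine x c) g.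
Proof.
have [sh|/swap_not_special->//] := boolP (special x h).
have bh : base x h by case/andP: sh.
have oh : occ x h by case/andP: bh.
have oh' : occ (swap h x) h by rewrite -(agree_occ (swap_agree (h := h) x)).
have [[e ->]|ne] := pselect (exists e, g = pair_site e h).
  by rewrite !thin_pair_site//= -[input _]/(swap h x) -[input (combine x c)]/x swap_special sh.
have [gr|gr] := boolP (g \in rest_sites h).
  have T1 : thin predT (combine (swap h x) c) g = plain (combine (swap h x) c) g.
    exact: (thin_rest _ (z := combine _ c) oh' gr).
  have T2 : thin predT (combine x c) g = plain (combine x c) g.
    exact: (thin_rest _ (z := combine _ c) oh gr).
  by rewrite T1 T2 /plain /combine /= swap_rest.
have gs : g \notin slot h.
  apply/negP => /slotP[i im gE].
  have [i6|i6] := leqP (m + 6) i.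
    by move/negP: gr; apply; rewrite gE; apply: map_f; rewrite mem_iota; lia.
  apply: ne; exists (i == m + 4)%N; rewrite gE /pair_site; congr (site _ _).
  by case: eqVneq => /=; lia.
have Q z : thin predT z g = thin (predC1 h) z g.
  by apply: thin_eq => e _ /=; case: eqVneq => //= oE; exfalso; apply: ne; exists e;
    rewrite -oE ownerK.
rewrite !Q; apply/esym/(agree_thin (h := h)) => //=; last by rewrite eqxx.
move=> [g' k]; rewrite slot_varsP// /combine /=; case: k => [|k] //=.
by rewrite !(andbT, andbF, orbF) => /(swap_agree (h := h) x).
Qed.

Lemma base_depends h :
  depends [seq site h i | i <- iota 0 (m + 7 + m)] (fun x => base x h).
Proof.
move=> x y xy.
have E j : (j < m + 7 + m)%N -> x (site h j) = y (site h j).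
  by move=> jm; apply: xy; apply: map_f; rewrite mem_iota.
rewrite /base /occ !E; [|lia..].
congr (_ && _ && _); apply: eq_in_all => g.
  by rewrite mem_iota => gm; rewrite E//; lia.
by move=> /rest_sitesP[j jm ->]; rewrite E//; lia.
Qed.

Lemma swap_mbool h i : mbool (fun x => swap h x i).
Proof.
have mb : mbool (fun x => base x h) := depends_mbool (@base_depends h).
rewrite (_ : (fun x => _) = fun x => if base x h then
    (if i == pair_site true h then x (pair_site false h)
     else if i == pair_site false h then x (pair_site true h) else x i) else x i).
  apply: mbool_if => //; last exact: mbool_coord.
  by case: (i == _); [|case: (i == _)]; exact: mbool_coord.
by apply/funext => x; rewrite /swap; case: ifP.
Qed.

(** * Amplification of bits over the tree *)

Section bits.
Implicit Types (k : G) (K : G -> bool) (f : G -> bool).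

Definition gap K g : nat := first_index (fun i => K (site g i)).
Definition next_site K g : G := site g (gap K g).

(** In this section [K] is the set of special sites and [f] a family of bits on
    it. The two differences below are the increments of [f] along the two edges
    that leave [k] in the forest on [K]. *)
Definition diff_a K f k : bool := f k (+) f (next_site K (k * a)%g).
Definition diff_b K f k : bool := f k (+) f (next_site K (k * a')%g).
Definition level K f n : G -> bool := iter n (diff_b K) f.

(** The bits of a special site k are the increments along a, at k, of the functions
    [level K f n], each of which consists of the increments of the previous one
    along a'. The site k serves all the sites whose next special site it is; since
    these are told apart by their distance to k, the level is a code of that
    distance and of the index of the bit. *)
Definition bit K f (v : bit_index G) : bool :=
  diff_a K (level K f (pickle (gap K v.1, v.2))) (next_site K v.1).

Definition walk (w : seq bool) : G := (\prod_(e <- w) (if e then a else a'))%g.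

(** All searches for the next special site succeed that start from a site reached
    from [g] by multiplying with [a] and [a'] on the right. *)
Definition recurrent K g : Prop := forall w, exists i, K (site (g * walk w)%g i).

Lemma walk_a w : (walk w * a)%g = walk (rcons w true).
Proof. by rewrite /walk -cats1 big_cat big_seq1. Qed.

Lemma walk_b w : (walk w * a')%g = walk (rcons w false).
Proof. by rewrite /walk -cats1 big_cat big_seq1. Qed.

Lemma walk_cat w w' : walk (w ++ w') = (walk w * walk w')%g.
Proof. by rewrite /walk big_cat. Qed.

Lemma walk_nseq n : walk (nseq n true) = (a ^+ n)%g.
Proof.
elim: n => [|n IH]; first by rewrite /walk big_nil.
by rewrite expgSr -IH walk_a -[in LHS](addn1 n) nseqD cats1.
Qed.

Lemma recurrent_walk K g w : recurrent K g -> recurrent K (g * walk w)%g.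
Proof. by move=> gK w'; have := gK (w ++ w'); rewrite walk_cat mulgA. Qed.

Lemma recurrent_next K g : recurrent K g -> K (next_site K g) /\ recurrent K (next_site K g).
Proof.
move=> gK; split.
  apply: (@firstP (fun i => K (site g i))); have := gK [::]; rewrite /walk big_nil mulg1; exact.
by rewrite /next_site /site -walk_nseq; apply: recurrent_walk.
Qed.

Lemma recurrent_a K k : recurrent K k -> recurrent K (k * a)%g.
Proof. by have := @recurrent_walk K k [:: true]; rewrite /walk big_seq1. Qed.

Lemma recurrent_b K k : recurrent K k -> recurrent K (k * a')%g.
Proof. by have := @recurrent_walk K k [:: false]; rewrite /walk big_seq1. Qed.

Lemma diff_aD K f f' k : diff_a K (fun k => f k (+) f' k) k = diff_a K f k (+) diff_a K f' k.
Proof. by rewrite /diff_a addbACA. Qed.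

Lemma levelD K f f' n k : level K (fun k => f k (+) f' k) n k = level K f n k (+) level K f' n k.
Proof.
elim: n k => //= n IH k; rewrite /diff_b -!/(level _ _ _) !IH.
by rewrite addbACA.
Qed.

Lemma bitD K f f' v : bit K (fun k => f k (+) f' k) v = bit K f v (+) bit K f' v.
Proof. by rewrite /bit -diff_aD; congr diff_a; apply/funext => k; rewrite levelD. Qed.

(** The searches from recurrent special sites end at recurrent special sites, so
    the values of [f] elsewhere have no influence there. *)
Lemma level_ext K f f' n k : (forall k, K k -> recurrent K k -> f k = f' k) ->
  K k -> recurrent K k -> level K f n k = level K f' n k.
Proof.
move=> ff; elim: n k => [|n IH] k Kk gk /=; first exact: ff.
rewrite /diff_b -!/(level _ _ _) IH//; congr (_ (+) _).
by have [] := recurrent_next (recurrent_b gk); apply: IH.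
Qed.

Lemma diff_a_ext K f f' k : (forall k, K k -> recurrent K k -> f k = f' k) ->
  K k -> recurrent K k -> diff_a K f k = diff_a K f' k.
Proof.
move=> ff Kk gk; rewrite /diff_a ff//; congr (_ (+) _).
by have [] := recurrent_next (recurrent_a gk); apply: ff.
Qed.

(** Linear functionals of [f] that read finitely many special sites reachable
    from [g]. Reachability confines the sites to a countable set, which matters
    when G is uncountable. *)
Definition supported K g (F : (G -> bool) -> bool) := exists l : seq G,
  (forall k, k \in l -> K k /\ exists w, k = (g * walk w)%g) /\
  (forall f, F f = \big[addb/false]_(k <- l) f k).

Lemma supportedD K g F F' : supported K g F -> supported K g F' ->
  supported K g (fun f => F f (+) F' f).
Proof.
move=> [l [lK lF]] [l' [lK' lF']]; exists (l ++ l'); split => [k|f].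
  by rewrite mem_cat => /orP[/lK|/lK'].
by rewrite big_cat /= lF lF'.
Qed.

Lemma reach_next K g k : (exists w, k = (g * walk w)%g) ->
  exists w, next_site K k = (g * walk w)%g.
Proof.
move=> [w kE]; exists (w ++ nseq (gap K k) true).
by rewrite /next_site /site {1}kE walk_cat walk_nseq mulgA.
Qed.

Lemma supported_level K g n k : K k -> recurrent K k ->
  (exists w, k = (g * walk w)%g) -> supported K g (fun f => level K f n k).
Proof.
elim: n k => [|n IH] k Kk gk kw.
  exists [:: k]; split => [k'|f]; last by rewrite big_seq1.
  by rewrite inE => /eqP->.
apply: (@supportedD _ _ (fun f => level K f n k)); first exact: IH.
have [Kn gn] := recurrent_next (recurrent_b gk).
apply: IH => //; apply: reach_next; have [w ->] := kw.
by exists (rcons w false); rewrite -mulgA walk_b.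
Qed.

Lemma supported_bit K v : recurrent K v.1 -> supported K v.1 (bit K ^~ v).
Proof.
move=> gv; have [Kk gk] := recurrent_next gv.
have kw : exists w, next_site K v.1 = (v.1 * walk w)%g.
  by apply: reach_next; exists [::]; rewrite /walk big_nil mulg1.
have [Kn gn] := recurrent_next (recurrent_a gk).
apply: (@supportedD _ _ (fun f => level K f _ _)); apply: supported_level => //.
apply: reach_next; have [w ->] := kw.
by exists (rcons w true); rewrite -mulgA walk_a.
Qed.

(** The two kinds of increments can be prescribed simultaneously on [K]. Let [f]
    be constant along the edges labelled a that start outside [K]; then it keeps
    the same value from any site to the next special site, and the requirements
    on [f] are increments along edges of the Cayley graph, which [gradient]
    integrates. *)
Lemma solve_diff K (f1 f2 : G -> bool) : exists f : G -> bool,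
  forall k, K k -> diff_a K f k = f1 k /\ diff_b K f k = f2 k.
Proof.
(* Outside of [K] the increments along a vanish. *)
pose incr s k : bool := if s == a then K k && f1 k else f2 k.
have [B HB] := gradient S_basis (incr : G -> G -> (bool : zmodType)).
have Ba k : B (k * a)%g = B k (+) (K k && f1 k).
  by rewrite HB// /incr eqxx.
have Bb k : B (k * a')%g = B k (+) f2 k.
  by rewrite HB// /incr eq_sym (negPf aa').
have Bnext k : B (next_site K k) = B k.
  rewrite /next_site; have : (gap K k <= gap K k)%N by [].
  elim: {1 3}(gap K k) => [|i IH] le; first by rewrite /site expg0 mulg1.
  rewrite -(addn1 i) -site_add {1}/site expg1 Ba IH; last exact: ltnW.
  by rewrite (negPf (first_min le)) addbF.
exists B => k Kk; rewrite /diff_a /diff_b !Bnext Ba Bb Kk.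
by rewrite !addKb.
Qed.

(** Integrate from the last level down to level 0. *)
Lemma solve_levels K n (F : nat -> G -> bool) (last : G -> bool) :
  exists f : G -> bool, forall k, K k -> recurrent K k ->
    level K f n k = last k /\
    forall i, (i < n)%N -> diff_a K (level K f i) k = F i k.
Proof.
elim: n F => [|n IH] F; first by exists last.
have [f1 Hf1] := IH (fun i => F i.+1).
have [f Hf] := solve_diff K (F 0%N) f1.
have E i k : K k -> recurrent K k -> level K f i.+1 k = level K f1 i k.
  move=> Kk gk; rewrite /level iterSr; apply: level_ext => // k' Kk' _.
  by have [] := Hf k' Kk'.
exists f => k Kk gk; split; first by rewrite E//; have [] := Hf1 k Kk gk.
case=> [_|i]; first by have [] := Hf k Kk.
rewrite ltnS => lin; have [_ <-//] := Hf1 k Kk gk.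
by apply: diff_a_ext => // k' Kk' gk'; exact: E.
Qed.

(** Any finite set of extracted bits takes any prescribed values for some [f];
    equivalently, as functionals of [f] these bits are linearly independent. *)
Lemma bits_separated K (t : seq (bit_index G)) v0 :
  (forall v, v \in t -> recurrent K v.1) -> v0 \in t ->
  exists f, forall v, v \in t -> bit K f v = (v == v0).
Proof.
move=> gt v0t.
(* The level and the special site determine the owner of a bit and its index. *)
pose code (v : bit_index G) := pickle (gap K v.1, v.2).
pose n := (\max_(v <- t) code v).+1.
have [f Hf] := solve_levels K n
  (fun i k => (i == code v0) && (k == next_site K v0.1)) (fun=> false).
exists f => v vt; have [Kn gn] := recurrent_next (gt v vt).
have [_ H] := Hf _ Kn gn; rewrite /bit H; last first.
  by rewrite ltnS; exact: (@leq_bigmax_seq _ _ xpredT code v vt).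
apply/andP/eqP => [[/eqP/(pcan_inj pickleK)[dE jE] /eqP]|->//].
rewrite /next_site dE /site => /mulIg gE.
by case: v v0 gE jE {vt v0t dE Kn gn H f Hf} => [? ?] [? ?] /= -> ->.
Qed.

End bits.

(** * Hidden bits as random variables *)

(** The hidden bit of a special site. It vanishes at all other sites, so an
    exchange at a special site [h] adds exactly the indicator of [h] to it ([swap_mark]). *)
Definition mark x k : bool := special x k && x (pair_site true k).

Definition fair_bit x : config (bit_index G) := bit (special x) (mark x).

Lemma mbool_special k : mbool (fun x => special x k).
Proof.
apply: mboolI; first exact: depends_mbool (@base_depends k).
by apply: mboolX; exact: mbool_coord.
Qed.

Lemma mbool_mark k : mbool (fun x => mark x k).
Proof. by apply: mboolI; [exact: mbool_special|exact: mbool_coord]. Qed.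

Lemma mbool_next (F : config G -> G -> bool) g : (forall k, mbool (F ^~ k)) ->
  mbool (fun x => F x (next_site (special x) g)).
Proof.
move=> mF; apply: (@mbool_case _ _ (fun x => gap (special x) g)
  (fun i x => F x (site g i))) => n; last exact: mF.
by apply: mbool_first => i; exact: mbool_special.
Qed.

Lemma mbool_level (F : config G -> G -> bool) n k : (forall k, mbool (F ^~ k)) ->
  mbool (fun x => level (special x) (F x) n k).
Proof.
move=> mF; elim: n k => [|n IH] k; first exact: mF.
apply: mboolX; first exact: IH.
exact: (mbool_next (F := fun x k => level (special x) (F x) n k)).
Qed.

Lemma mbool_bit (F : config G -> G -> bool) v : (forall k, mbool (F ^~ k)) ->
  mbool (fun x => bit (special x) (F x) v).
Proof.
move=> mF; apply: (@mbool_case _ _ (fun x => gap (special x) v.1)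
  (fun i x => diff_a (special x) (level (special x) (F x) (pickle (i, v.2))) (site v.1 i))) => n.
  by apply: mbool_first => i; exact: mbool_special.
apply: mboolX; first exact: mbool_level.
by apply: (mbool_next (F := fun x k => level (special x) (F x) _ k)) => k; exact: mbool_level.
Qed.

Lemma swap_specialE h x : special (swap h x) = special x.
Proof. by apply/funext => k; rewrite swap_special. Qed.

Lemma swap_mark h x : special x h ->
  mark (swap h x) = fun k => mark x k (+) (k == h).
Proof.
by move=> sh; apply/funext => k; rewrite /mark swap_specialE swap_bit.
Qed.

Definition parity (t : seq (bit_index G)) x (F : G -> bool) : bool :=
  \big[addb/false]_(v <- t) bit (special x) F v.

Lemma parityD t x F F' :
  parity t x (fun k => F k (+) F' k) = parity t x F (+) parity t x F'.
Proof.
rewrite /parity -big_split; apply: eq_bigr => v _; exact: bitD.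
Qed.

Lemma swap_parity h t x F : parity t (swap h x) F = parity t x F.
Proof. by rewrite /parity swap_specialE. Qed.

Lemma mbool_parity (F : config G -> G -> bool) t : (forall k, mbool (F ^~ k)) ->
  mbool (fun x => parity t x (F x)).
Proof.
move=> mF; elim: t => [|v t IH].
  rewrite (_ : (fun x => _) = fun=> false); first exact: mbool_cst.
  by apply/funext => x; rewrite /parity big_nil.
rewrite (_ : (fun x => _) = fun x => bit (special x) (F x) v (+) parity t x (F x)).
  by apply: mboolX => //; exact: mbool_bit.
by apply/funext => x; rewrite /parity big_cons.
Qed.

(** An exchange at [h] flips the sum of the bits in [t]. *)
Definition pivot t x h : bool := special x h && parity t x (fun k => k == h).

Lemma swap_pivot h' t x h : pivot t (swap h' x) h = pivot t x h.
Proof. by rewrite /pivot swap_specialE swap_parity. Qed.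

Lemma mbool_pivot t h : mbool (fun x => pivot t x h).
Proof.
apply: mboolI; first exact: mbool_special.
by apply: (mbool_parity (F := fun _ k => k == h)) => k; exact: mbool_cst.
Qed.

Lemma supported_parity t x : (forall v, v \in t -> recurrent (special x) v.1) ->
  exists l : seq G,
  (forall k, k \in l -> special x k /\ exists v w, v \in t /\ k = (v.1 * walk w)%g) /\
  (forall F, parity t x F = \big[addb/false]_(k <- l) F k).
Proof.
elim: t => [|v t IH] gt.
  by exists [::]; split => // F; rewrite /parity !big_nil.
have [|l [lK lF]] := IH; first by move=> u ut; apply: gt; rewrite inE ut orbT.
have [|l' [lK' lF']] := supported_bit (K := special x) (v := v).
  by apply: gt; rewrite mem_head.
exists (l' ++ l); split => [k|F].
  rewrite mem_cat => /orP[/lK' [sk [w kE]]|/lK [sk [u [w [ut kE]]]]]; split=> //.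
    by exists v, w; rewrite mem_head.
  by exists u, w; rewrite inE ut orbT.
by rewrite big_cat /= -lF -lF' /parity big_cons.
Qed.

(** The functional that sums [F] over a list only sees the elements with odd
    multiplicity. *)
Lemma addb_undup (l : seq G) (F : G -> bool) :
  \big[addb/false]_(k <- l) F k =
  \big[addb/false]_(h <- undup l) (F h && \big[addb/false]_(k <- l) (k == h)).
Proof.
under [RHS]eq_bigr do rewrite big_distrr /=.
rewrite exchange_big /= big_seq [RHS]big_seq; apply: eq_bigr => k kl.
rewrite (bigD1_seq k) ?mem_undup ?undup_uniq//= eqxx andbT.
by rewrite big1 ?addbF// => h /negPf hk; rewrite eq_sym hk andbF.
Qed.

(** The sum of the bits in [t] is not the zero functional, by [bits_separated],
    and it reads finitely many sites; so it must see one of them. *)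
Lemma pivot_exists t x : uniq t -> t != [::] -> (forall v, v \in t -> recurrent (special x) v.1) ->
  exists v w, v \in t /\ pivot t x (v.1 * walk w)%g.
Proof.
case: t => // v0 t ut _ gt.
have [F FE] := bits_separated gt (mem_head v0 t).
have [l [lK lF]] := supported_parity gt.
have : parity (v0 :: t) x F.
  rewrite /parity (eq_big_seq _ FE) (bigD1_seq v0) ?mem_head//= eqxx.
  by rewrite big1// => v /negPf.
rewrite lF addb_undup => sum1.
have [[h hl hF]|no] := pselect (exists2 h, h \in l & \big[addb/false]_(k <- l) (k == h)).
  have [sh [v [w [vt hE]]]] := lK h hl.
  by exists v, w; split=> //; rewrite -hE /pivot sh lF.
move: sum1; rewrite big_seq big1// => h; rewrite mem_undup => hl.
by apply/negbTE/negP => /andP[_ hF]; apply: no; exists h.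
Qed.

Context (R : realType) (kappa : probability bool R) (r theta : R).
Local Notation E := (expect (@product_measure R G kappa)).
Local Notation half := (fun=> 1 / 2 : R).
Let p : R := fine (kappa [set true]).

Lemma thin_gain_loss Q z e h : occ (input z) h -> ~~ Q h ->
  (thin (predU1 h Q) z (pair_site e h))%:R - (thin Q z (pair_site e h))%:R =
  (gain e h z)%:R - (loss e h z)%:R :> R.
Proof.
move=> oh Qh; rewrite !thin_pair_site// (negPf Qh) /= eqxx /=.
have -> : gain e h z = compensated z h && (z (h, 3%N) == e).
  by rewrite /gain /compensated oh /= !andbA.
have -> : loss e h z = special (input z) h && plain z (pair_site e h).
  rewrite /loss /special /base oh /= /plain /input andbC -!andbA.
  case: (all _ _) => //=; rewrite ?andbF //.
  by clear; case: e; case: (z (pair_site true h, 0%N));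
    case: (z (pair_site false h, 0%N)) => //=; rewrite ?andbF ?andbT.
have : compensated z h -> special (input z) h = false /\ plain z (pair_site e h) = false.
  move=> /and5P[_ x1 x2 u1 /andP[u2 _]]; split.
    by rewrite /special /input x1 x2 andbF.
  by rewrite /plain; case: (e); rewrite ?(negPf u1) ?(negPf u2) andbF.
case: (compensated z h) => [[//|-> ->]|_] /=; first by case: (_ == _).
by case: (special _ _); case: (plain _ _); rewrite ?subrr ?subr0.
Qed.

Definition weight (v : var) : R :=
  match v.2 with 0%N => p | 1%N => r | 2%N => theta | _ => 1 / 2 end.

Definition pairs (l : seq G) : seq var := flatten [seq [:: (g, 0%N); (g, 1%N)] | g <- l].

Lemma mem_pairs l g k : ((g, k) \in pairs l) = (g \in l) && (k < 2)%N.
Proof.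
elim: l => //= h l IH; rewrite !inE IH !xpair_eqE.
by case: (g == h) => //=; case: k {IH} => [|[|k]]; rewrite ?andbT ?andbF ?orbF.
Qed.

Lemma avg_pairs (f : bool -> bool -> bool) l z : uniq l ->
  avg weight (pairs l) (fun z => (all (fun g => f (z (g, 0%N)) (z (g, 1%N))) l)%:R) z =
  (p * r * (f true true)%:R + p * (1 - r) * (f true false)%:R +
   (1 - p) * r * (f false true)%:R + (1 - p) * (1 - r) * (f false false)%:R) ^+ size l.
Proof.
elim: l => [_ //|g l IH /= /andP[gl ul]].
rewrite exprS -IH//.
have -> : (fun z => (f (z (g, 0%N)) (z (g, 1%N)) &&
     all (fun g => f (z (g, 0%N)) (z (g, 1%N))) l)%:R : R) =
   (fun z => (f (z (g, 0%N)) (z (g, 1%N)))%:R *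
     (all (fun g => f (z (g, 0%N)) (z (g, 1%N))) l)%:R).
  by apply/funext => z'; rewrite -natrM mulnb.
rewrite -[LHS]/(avg weight ([:: (g, 0%N); (g, 1%N)] ++ pairs l) _ z) avg_mul; first last.
- move=> [g' k]; rewrite mem_pairs !inE !xpair_eqE => /orP[] /andP[/eqP-> _];
    by rewrite (negPf gl).
- apply: (depends_comp (fun b : bool => b%:R)); apply: depends_all => g' gl' z1 z2 zz.
  by rewrite !zz// mem_pairs gl'.
- by move=> z1 z2 zz; rewrite !zz// !inE eqxx ?orbT.
congr (_ * _); rewrite /= /avg1 /update /weight /= !xpair_eqE /= !eqxx ?andbF ?andbT /=.
ring.
Qed.

Lemma avg_var v b z : avg weight [:: v] (fun z => (z v == b)%:R) z =
  if b then weight v else 1 - weight v.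
Proof. by rewrite /= /avg1 /update eqxx; case: b; rewrite /=; ring. Qed.

Lemma rest_uniq h : uniq (rest_sites h).
Proof.
rewrite map_inj_uniq ?iota_uniq// => i j; exact: site_inj.
Qed.

Lemma avg_and s t (f k : config var -> bool) z : depends s f -> depends t k ->
  (forall i, i \in s -> i \in t -> False) ->
  avg weight (s ++ t) (fun z => (f z && k z)%:R) z =
  avg weight s (fun z => (f z)%:R) z * avg weight t (fun z => (k z)%:R) z.
Proof.
move=> fs kt st; rewrite -avg_mul//; last 2 first.
- exact: (depends_comp (fun b : bool => b%:R) fs).
- exact: (depends_comp (fun b : bool => b%:R) kt).
by congr (avg _ _ _ _); apply/funext => z'; rewrite -natrM mulnb.
Qed.

Lemma pair_site_neq h : (pair_site true h == pair_site false h) = false.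
Proof. by apply/eqP => /(pair_site_inj). Qed.

Lemma avg_loss e h z : avg weight (slot_vars h) (fun z => (loss e h z)%:R) z =
  p * r * (1 - p) * (1 - p) ^+ m.
Proof.
pose s := [:: (pair_site e h, 0%N)] ++ [:: (pair_site e h, 1%N)] ++
  [:: (pair_site (~~ e) h, 0%N)] ++ pairs (rest_sites h).
have pe : (pair_site e h == pair_site (~~ e) h) = false.
  by apply/eqP => /(pair_site_inj); case: (e).
have pr e' : pair_site e' h \in rest_sites h = false.
  exact/negbTE/pair_not_rest.
have rest_dep : depends (pairs (rest_sites h))
    (fun z => all (fun g => ~~ z (g, 0%N)) (rest_sites h)).
  apply: depends_all => g gr z1 z2 zz; rewrite zz// mem_pairs gr//.
rewrite (avg_indep weight (t := s) z z).
- rewrite /s /loss avg_and; last 3 first.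
  + by move=> z1 z2 zz; rewrite zz ?mem_head.
  + move=> z1 z2 zz; rewrite !(zz (_, _)) ?mem_cat ?inE ?eqxx ?orbT//.
    congr (_ && (_ && _)); apply: rest_dep => v vr.
    by apply: zz; rewrite !mem_cat vr !orbT.
  + move=> [g k]; rewrite !inE => /eqP[-> ->].
    by rewrite mem_pairs !xpair_eqE pe pr andbF.
  rewrite avg_and; last 3 first.
  + by move=> z1 z2 zz; rewrite zz ?mem_head.
  + move=> z1 z2 zz; rewrite !(zz (_, _)) ?mem_cat ?inE ?eqxx ?orbT//.
    congr (_ && _); apply: rest_dep => v vr.
    by apply: zz; rewrite !mem_cat vr !orbT.
  + move=> [g k]; rewrite !inE => /eqP[-> ->].
    by rewrite mem_pairs !xpair_eqE pr andbF.
  rewrite avg_and; last 3 first.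
  + by move=> z1 z2 zz; rewrite zz ?mem_head.
  + exact: rest_dep.
  + move=> [g k]; rewrite !inE => /eqP[-> ->].
    by rewrite mem_pairs pr.
  rewrite (avg_pairs (fun b _ => ~~ b) _ (rest_uniq h)) size_map size_iota.
  rewrite /= /avg1 /update !eqxx /weight /=.
  have -> : p * r * 0 + p * (1 - r) * 0 + (1 - p) * r * 1 + (1 - p) * (1 - r) * 1 =
    1 - p by ring.
  ring.
- move=> z1 z2 zz; congr ((nat_of_bool _)%:R); rewrite /loss !zz ?slot_varsP ?pair_slot//.
  do 3 congr (_ && _); apply: eq_in_all => g /rest_slot gs.
  by rewrite zz// slot_varsP gs.
- move=> z1 z2 zz; congr ((nat_of_bool _)%:R); rewrite /loss.
  rewrite !(zz (pair_site _ _, _)) ?mem_cat ?inE ?eqxx ?orbT//.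
  do 3 congr (_ && _); apply: rest_dep => v vr.
  by apply: zz; rewrite !mem_cat vr !orbT.
Qed.

Lemma avg_gain e h z : avg weight (slot_vars h) (fun z => (gain e h z)%:R) z =
  p ^+ 2 * (1 - r) ^+ 2 * (1 - p * r) ^+ m * (theta / 2).
Proof.
pose s := [:: (pair_site true h, 0%N)] ++ [:: (pair_site false h, 0%N)] ++
  [:: (pair_site true h, 1%N)] ++ [:: (pair_site false h, 1%N)] ++
  pairs (rest_sites h) ++ [:: (h, 2%N)] ++ [:: (h, 3%N)].
have pe := pair_site_neq h.
have pr e' : pair_site e' h \in rest_sites h = false.
  exact/negbTE/pair_not_rest.
have rest_dep : depends (pairs (rest_sites h))
    (fun z => all (fun g => ~~ plain z g) (rest_sites h)).
  by apply: depends_all => g gr z1 z2 zz; rewrite /plain !zz// mem_pairs gr//.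
have dep (z1 z2 : config var) (t : seq var) : {subset pairs (rest_sites h) <= t} ->
    (forall v, v \in t -> z1 v = z2 v) ->
    all (fun g => ~~ plain z1 g) (rest_sites h) = all (fun g => ~~ plain z2 g) (rest_sites h).
  by move=> st zz; apply: rest_dep => v /st; apply: zz.
rewrite (avg_indep weight (t := s) z z).
- rewrite /s /gain.
  do 4 (rewrite avg_and; last 3 first;
  [ by move=> z1 z2 zz; rewrite zz ?mem_head
  | by move=> z1 z2 zz; rewrite !(zz (_, _)) ?mem_cat ?inE ?eqxx ?orbT//;
     do ?congr (_ && _); apply: dep zz => v vr; rewrite !mem_cat vr ?orbT
  | by move=> [g k]; rewrite !(inE, mem_cat) => /eqP[-> ->];
    rewrite mem_pairs !xpair_eqE ?pe ?pr ?andbF |]).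
  rewrite avg_and; last 3 first.
  + exact: rest_dep.
  + by move=> z1 z2 zz; rewrite !zz ?inE ?eqxx ?orbT.
  + by move=> [g k]; rewrite mem_pairs !inE !xpair_eqE => /andP[_];
      case: k => [|[|//]]; rewrite !andbF.
  rewrite avg_and; last 3 first.
  + by move=> z1 z2 zz; rewrite zz ?mem_head.
  + by move=> z1 z2 zz; rewrite zz ?mem_head.
  + by move=> [g k]; rewrite !inE => /eqP[-> ->]; rewrite xpair_eqE andbF.
  rewrite avg_var (avg_pairs (fun b c => ~~ (b && c)) _ (rest_uniq h)) size_map size_iota.
  rewrite /= /avg1 /update !eqxx /weight /=.
  have -> : p * r * 0 + p * (1 - r) * 1 + (1 - p) * r * 1 + (1 - p) * (1 - r) * 1 =
    1 - p * r by ring.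
  by case: (e) => /=; lra.
- move=> z1 z2 zz; congr ((nat_of_bool _)%:R); rewrite /gain.
  rewrite !zz ?slot_varsP ?pair_slot ?eqxx ?orbT//.
  do 4 congr (_ && _); congr (_ && _); apply: eq_in_all => g /rest_slot gs.
  by rewrite /plain !zz// slot_varsP gs.
- move=> z1 z2 zz; congr ((nat_of_bool _)%:R); rewrite /gain.
  rewrite !(zz (_, _)) ?mem_cat ?inE ?eqxx ?orbT//.
  do 4 congr (_ && _); congr (_ && _); apply: dep zz => v vr.
  by rewrite !mem_cat vr !orbT.
Qed.

(** The defining property of [theta]: [gain] and [loss] have the same probability
    ([avg_gain] and [avg_loss]). *)
Hypothesis balance :
  p ^+ 2 * (1 - r) ^+ 2 * (1 - p * r) ^+ m * (theta / 2) =
  p * r * (1 - p) * (1 - p) ^+ m.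

(** Resample what is private to the occurrence at [h], everything else being
    fixed. Switching on the modification at [h] can change the event that all
    sites of [F] are kept only if exactly one site of the slot lies in [F], and
    this site is one of the first two. Indeed the modification matters only when
    at most one site of the slot is kept in the end, before and after it. In the
    remaining case the change is [gain] minus [loss], multiplied by a factor that
    does not depend on the resampled coordinates. *)
Lemma all_thin_switch F h Q z : ~~ Q h -> uniq F ->
  avg weight (slot_vars h) (fun z => (all (thin (predU1 h Q) z) F)%:R -
                              (all (thin Q z) F)%:R) z = 0.
Proof.
move=> Qh uF.
have off z' g : occ (input z') h = false \/ (forall e, g != pair_site e h) ->
    thin (predU1 h Q) z' g = thin Q z' g.
  move=> H; apply: thin_eq => e oe /=; case: eqVneq => //= oh.
  case: H => [no|/(_ e)]; first by rewrite -oh oe in no.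
  by rewrite -oh ownerK eqxx.
have same z' : (forall g, g \in F -> thin (predU1 h Q) z' g = thin Q z' g) ->
    all (thin (predU1 h Q) z') F = all (thin Q z') F.
  exact: eq_in_all.
have zero (f k : config var -> bool) : f =1 k ->
    avg weight (slot_vars h) (fun z => (f z)%:R - (k z)%:R) z = 0.
  move=> fk; rewrite [X in avg weight _ X](_ : _ = fun=> 0) ?avg_cst//.
  by apply/funext => z'; rewrite fk subrr.
case: (pselect (exists e, pair_site e h \in F)) => [[e eF]|nF]; last first.
  apply: zero => z'; apply: same => g gF; apply: off; right => e.
  by apply/negP => /eqP gE; apply: nF; exists e; rewrite -gE.
(* If [F] has another site in the slot, the modification at [h] never matters. *)
case: (pselect (exists2 g, g \in F & (g != pair_site e h) && (g \in slot h))).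
  move=> [g gF /andP[ge gs]]; apply: zero => z'.
  case oh: (occ (input z') h); last by apply: same => g' _; apply: off; left.
  have g_other : g = pair_site (~~ e) h \/ g \in rest_sites h.
    have [i im gE] := slotP gs.
    have [i6|i6] := leqP (m + 6) i.
      by right; rewrite gE; apply: map_f; rewrite mem_iota; lia.
    left; rewrite gE /pair_site; congr (site _ _).
    have : i != (m + 4 + ~~ e)%N by apply: contraNneq ge => iE; rewrite gE iE.
    by case: (e) => /=; lia.
  have TE e' := thin_pair_site (predU1 h Q) e' oh.
  have TE' e' := thin_pair_site Q e' oh.
  (* If [h] is special, its two letters are erased after the switch; before it,
     one of the two sites of [F] in the slot carries a 0. *)
  case sp: (special (input z') h).
    transitivity false.
      by apply/negbTE/allPn; exists (pair_site e h) => //; rewrite TE /= eqxx sp.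
    apply/esym/negbTE/allPn; move: sp; rewrite /special /base oh /= => /andP[/allP rs xx].
    case: g_other => gE; last first.
      by exists g => //; rewrite (thin_rest _ oh gE) /plain negb_and rs.
    rewrite gE in gF.
    have H e' : ~~ thin Q z' (pair_site e' h) \/ input z' (pair_site e' h).
      rewrite TE' (negPf Qh) /= /plain /input.
      by case: (z' (_, 0%N)); [right|left].
    case: (H e) => [He|He]; first by exists (pair_site e h).
    case: (H (~~ e)) => [He'|He']; first by exists (pair_site (~~ e) h).
    by exfalso; move: xx He He'; case: (e) => /=; case: (input _ _) => //=; case: (input _ _).
  (* If [h] is compensated, at most one site of the slot is kept. *)
  case cp: (compensated z' h).
    have [p1 p2] : ~~ plain z' (pair_site true h) /\ ~~ plain z' (pair_site false h).
      by case/and5P: cp => _ _ _ u1 /andP[u2 _]; rewrite /plain !negb_and u1 u2 !orbT.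
    transitivity false; last first.
      apply/esym/negbTE/allPn; exists (pair_site e h) => //.
      by rewrite TE' (negPf Qh) /=; case: (e).
    apply/negbTE/allPn; case: g_other => gE; last first.
      exists g => //; rewrite (thin_rest _ oh gE).
      by case/and5P: cp => _ _ _ _ /and3P[_ /allP rp _]; apply: rp.
    rewrite gE in gF; exists (if z' (h, 3%N) == e then pair_site (~~ e) h else pair_site e h).
      by case: ifP.
    case: ifP => De; rewrite TE sp /= eqxx cp /= ?De; last by case: (e).
    by move: De; case: (z' _); case: (e).
  apply: same => g' g'F; case: (pselect (exists e', g' = pair_site e' h)) => [[e' ->]|ne].
    by rewrite TE TE' sp cp !andbF.
  by apply: off; right => e'; apply/eqP => ?; apply: ne; exists e'.
move=> nF.
(* The only site of the slot in [F] is [pair_site e h]. *)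
pose F' := rem (pair_site e h) F.
have F'P g : g \in F' -> g \notin slot h.
  rewrite mem_rem_uniq// inE => /andP[ge gF]; apply/negP => gs.
  by apply: nF; exists g => //; rewrite ge.
have allF (f : pred G) : all f F = f (pair_site e h) && all f F'.
  by rewrite (eq_all_r (perm_mem (perm_to_rem eF))).
(* The factor that does not depend on what is resampled. *)
pose k z' : R := (occ (input z') h)%:R * (all (thin Q z') F')%:R.
rewrite [X in avg weight _ X](_ : _ = fun z' => k z' * ((gain e h z')%:R - (loss e h z')%:R)).
  rewrite avg_pull ?avgB; first by rewrite avg_gain avg_loss balance subrr mulr0.
  move=> v b z' vs; rewrite /k -(agree_occ (agree_input (agree_update b z' vs))).
  case oh: (occ _ _); last by rewrite !mul0r.
  congr (_ * _%:R); congr nat_of_bool; apply: eq_in_all => g /F'P gs.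
  exact/esym/(agree_thin (agree_update b z' vs)).
apply/funext => z'; rewrite /k !allF.
case oh: (occ (input z') h); last first.
  rewrite off; last by left.
  rewrite (_ : all (thin (predU1 h Q) z') F' = all (thin Q z') F') ?subrr ?mul0r//.
  by apply: eq_in_all => g _; apply: off; left.
rewrite (_ : all (thin (predU1 h Q) z') F' = all (thin Q z') F').
  rewrite -(thin_gain_loss e oh Qh) -!mulnb !natrM mul1r; ring.
apply: eq_in_all => g /F'P gs; apply: off; right => e'.
by apply: contraNneq gs => ->; apply: pair_slot.
Qed.

(** Only finitely many occurrences can influence [F], so finitely many switches
    lead from the plain to the modified thinning. *)
Lemma avg_all_thin F S z : uniq F ->
  (forall Q, depends S (fun z => all (thin Q z) F)) ->
  avg weight S (fun z => (all (thin predT z) F)%:R) z = (p * r) ^+ size F.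
Proof.
move=> uF SF.
pose Hs := undup (flatten [seq [:: owner true g; owner false g] | g <- F]).
have dep Q : depends S (fun z => (all (thin Q z) F)%:R : R).
  exact: (depends_comp (fun b : bool => b%:R) (SF Q)).
have drop (l : seq G) : uniq l -> avg weight S (fun z => (all (thin (mem l) z) F)%:R) z =
    avg weight S (fun z => (all (thin pred0 z) F)%:R) z.
  elim: l => [_ |h l IH /= /andP[hl ul]]; first by [].
  rewrite -IH//; apply/eqP; rewrite -subr_eq0.
  have H := avgB weight S (fun z => (all (thin (mem (h :: l)) z) F)%:R)
       (fun z => (all (thin (mem l) z) F)%:R).
  rewrite -[X in X == _](congr1 (@^~ z) H).
  set D := (X in avg weight S X).
  have dD : depends S D by apply: (depends_comp2 (fun b c : R => b - c)); apply: dep.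
  have -> : avg weight S D z = avg weight (slot_vars h) (avg weight S D) z.
    by rewrite (avg_id weight (s := slot_vars h))// => *; apply: avg_const.
  rewrite avgC (_ : avg weight (slot_vars h) D = fun=> 0) ?avg_cst//.
  by apply/funext => z'; apply: all_thin_switch.
have -> : (fun z => (all (thin predT z) F)%:R : R) = (fun z => (all (thin (mem Hs) z) F)%:R).
  apply/funext => z'; congr ((nat_of_bool _)%:R); apply: eq_in_all => g gF.
  apply: thin_eq => e _ /=; rewrite mem_undup; apply/esym/flattenP.
  exists [:: owner true g; owner false g].
    by apply: (map_f (fun g => [:: owner true g; owner false g])).
  by rewrite !inE; case: (e); rewrite eqxx ?orbT.
rewrite drop ?undup_uniq//.
have -> : (fun z => (all (thin pred0 z) F)%:R : R) = (fun z => (all (plain z) F)%:R) by [].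
rewrite (avg_indep weight (t := pairs F) z z); last 2 first.
- exact: (dep pred0).
- apply: (depends_comp (fun b : bool => b%:R)); apply: depends_all => g gF z1 z2 zz.
  by rewrite /plain !zz// mem_pairs gF.
by rewrite (avg_pairs andb)//=; congr (_ ^+ _); ring.
Qed.

Hypothesis p01 : 0 < p < 1.

Let p_ge0_le1 : 0 <= p <= 1.
Proof. by case/andP: p01 => p0 p1; rewrite !ltW. Qed.

(** Resample the two letters of the pair: their four values are permuted by the
    exchange in a way that preserves the weights. *)
Lemma expect_swap h f : bounded_mfun f -> E (fun x => f (swap h x)) = E f.
Proof.
move=> bf; have bfs : bounded_mfun (fun x => f (swap h x)).
  by apply: bm_comp_config => // i; apply: swap_mbool.
have ba i f' : bounded_mfun f' -> bounded_mfun (avg1 (fun=> p) i f').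
  move=> bf'; apply: bmD; apply: bmZ; apply: bm_comp_config => //; exact: update_mbool.
have two f' : bounded_mfun f' -> E f' =
    E (avg1 (fun=> p) (pair_site true h) (avg1 (fun=> p) (pair_site false h) f')).
  by move=> bf'; rewrite -resample//; [apply: resample|apply: ba].
rewrite two// [RHS]two//; congr expect; apply/funext => x.
have bu b b' : base (update (pair_site false h) b (update (pair_site true h) b' x)) h =
               base x h.
  rewrite /base; set y := update _ _ _.
  have yx : agree_off h y x.
    move=> g gs; rewrite /y /update !ifN//; apply: contraNneq gs => ->; exact: pair_slot.
  rewrite (agree_occ yx); congr (_ && _); apply: eq_in_all => g gr.
  by rewrite /y /update !ifN//; apply: contraTneq gr => ->; apply: pair_not_rest.
have [bh|/negPf bh] := boolP (base x h); last first.
  by rewrite /avg1 /swap !bu !bh.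
have sw b b' : swap h (update (pair_site false h) b (update (pair_site true h) b' x)) =
    update (pair_site false h) b' (update (pair_site true h) b x).
  apply/funext => g; rewrite /swap bu bh /update.
  case: (eqVneq g (pair_site true h)) => [->|gT].
    by rewrite eqxx eq_sym pair_site_TF.
  by case: (eqVneq g (pair_site false h)) => // gF; rewrite eq_sym pair_site_TF eqxx.
rewrite /avg1 !sw; ring.
Qed.

(** * Special sites recur on every a-line *)

(** The letters of one special pattern, the one with free word 10 0^m. Its
    occurrences in disjoint windows are independent, with the same positive
    probability. *)
Definition pattern i : bool := (i < m + 3)%N || (i == m + 4)%N.
Definition window_length := (m + 7 + m)%N.
Definition matches x h : bool :=
  all (fun i => x (site h i) == pattern i) (iota 0 window_length).

Lemma matches_special x h : matches x h -> special x h.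
Proof.
move=> /allP xh.
have E i : (i < window_length)%N -> x (site h i) = pattern i.
  by move=> iw; apply/eqP/xh; rewrite mem_iota.
rewrite /window_length in E.
rewrite /special /base /occ /pair_site !E; [|move=> /=; lia..].
apply/andP; split; last by rewrite /pattern /=; lia.
apply/andP; split.
  apply/and3P; split; try by rewrite /pattern; lia.
  by apply/allP => i; rewrite mem_iota => im; rewrite E /pattern; lia.
by apply/allP => g /rest_sitesP[i im ->]; rewrite E /pattern; lia.
Qed.

Definition match_prob : R := \prod_(i <- iota 0 window_length) (if pattern i then p else 1 - p).

Lemma avg_matches_seq h js x0 : uniq js ->
  avg (fun=> p) [seq site h i | i <- js]
    (fun x => (all (fun i => x (site h i) == pattern i) js)%:R) x0 =
  \prod_(i <- js) (if pattern i then p else 1 - p).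
Proof.
elim: js => [|i js IH] in x0 *; first by rewrite big_nil.
move=> /= /andP[ij ujs]; rewrite big_cons -(IH x0 ujs).
have fresh e u y : u \in [seq site h i | i <- js] ->
    ((update u e y (site h i) == pattern i)%:R = (y (site h i) == pattern i)%:R :> R).
  move=> /mapP[j jjs ->]; rewrite /update ifN//.
  by apply: contraNneq ij => /(site_inj) ->.
under [X in avg _ _ X]eq_fun do rewrite -mulnb natrM.
rewrite avg_pull; last by move=> u e y; exact: fresh.
rewrite /avg1 -/(avg _ _ _).
set f := (fun x => _).
have fd : depends [seq site h i | i <- js] f.
  apply: (depends_comp (fun b : bool => b%:R)); apply: depends_all => j jjs.
  by move=> y y' yy; rewrite yy// map_f.
rewrite !(avg_const _ _ x0 fd) /update eqxx.
by case: (pattern i) => /=; ring.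
Qed.

Lemma match_prob01 : 0 < match_prob <= 1.
Proof.
rewrite /match_prob; elim: (iota _ _) => [|i l IH].
  by rewrite big_nil; lra.
rewrite big_cons; set q := (\prod_(j <- l) _) in IH *.
have : 0 < (if pattern i then p else 1 - p) < 1 by case: (pattern i); move: p01; lra.
by move: (if _ then _ else _) => u u01; nra.
Qed.

Definition window_sites g j : seq G :=
  [seq site g (j * window_length + i) | i <- iota 0 window_length].

Lemma matches_depends g j : depends (window_sites g j)
  (fun x => matches x (site g (j * window_length))).
Proof.
apply: depends_all => i ii x y xy; rewrite site_add xy//.
exact: (map_f (fun i => site g (j * window_length + i))).
Qed.

Lemma avg_no_match g js x0 : uniq js ->
  avg (fun=> p) (flatten [seq window_sites g j | j <- js])
    (fun x => (all (fun j => ~~ matches x (site g (j * window_length))) js)%:R) x0 =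
  (1 - match_prob) ^+ size js.
Proof.
elim: js => [//|j js IH] /andP[jj ujs].
rewrite [flatten _]/= [size _]/= exprS -IH//.
under [X in avg _ _ X]eq_fun do rewrite /= -mulnb natrM.
rewrite avg_mul; last 3 first.
- apply: (depends_comp (fun e : bool => (~~ e)%:R)); exact: matches_depends.
- apply: (depends_comp (fun e : bool => e%:R)); apply: depends_all => j' jj'.
  move=> y y' yy; congr (~~ _); apply: matches_depends => u uj; apply: yy.
  by apply/flattenP; exists (window_sites g j') => //; exact: map_f.
- move=> u /mapP[i]; rewrite mem_iota => /andP[_ ilt] -> /flattenP[_ /mapP[j' jj' ->]].
  move=> /mapP[i']; rewrite mem_iota => /andP[_ ilt'] /(site_inj) e.
  move/negP: jj; apply; suff -> : j = j' by [].
  have := congr1 (fun n => n %/ window_length)%N e.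
  have w0 : (0 < window_length)%N by rewrite /window_length; lia.
  by rewrite !divnMDl// !divn_small// !addn0.
congr (_ * _).
have -> : (fun x => (~~ matches x (site g (j * window_length)))%:R : R) =
    fun x => 1 - (matches x (site g (j * window_length)))%:R.
  by apply/funext => x; case: (matches _ _); rewrite /= ?mulr1n ?mulr0n; ring.
rewrite avgB avg_cst; congr (_ - _).
rewrite /match_prob -(avg_matches_seq (site g (j * window_length)) x0 (iota_uniq 0 window_length)).
by congr (avg _ _ _ _); apply: eq_map => i; rewrite site_add.
Qed.

(** The probability that no special site follows [g] is at most that of not seeing
    the pattern in the first N disjoint windows, for every N. *)
Lemma expect_recurrent g : E (fun x => (`[< exists i, special x (site g i) >])%:R) = 1.
Proof.
have mx : mbool (fun x => `[< exists i, special x (site g i) >]).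
  by apply: (mbool_exists (f := fun i x => special x (site g i))) => i; exact: mbool_special.
have bx := @bm_mbool _ _ R _ mx.
have bN : bounded_mfun (fun x => 1 - (`[< exists i, special x (site g i) >])%:R : R).
  by apply: bmB => //; exact: bm_cst.
apply/eqP; rewrite eq_sym -subr_eq0 -{1}(expect_cst (@product_measure R G kappa) 1).
rewrite -expectB//; last exact: bm_cst.
rewrite eq_le expect_ge0 ?andbT//; last first.
  by move=> x; case: asboolP => _; rewrite ?subrr ?subr0.
have [c0 c1] := andP match_prob01.
rewrite leNgt; apply/negP => E0.
have lim : (fun n => (1 - match_prob) ^+ n) @ \oo --> (0 : R).
  by apply: cvg_expr; rewrite ger0_norm; lra.
have [N _ /(_ N (leqnn N))] := cvgr_lt _ lim _ E0.
apply/negP; rewrite -leNgt.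
pose f x : R := (all (fun j => ~~ matches x (site g (j * window_length))) (iota 0 N))%:R.
have fd : depends (flatten [seq window_sites g j | j <- iota 0 N]) f.
  apply: (depends_comp (fun e : bool => e%:R)); apply: depends_all => j' jj'.
  move=> y y' yy; congr (~~ _); apply: matches_depends => u uj; apply: yy.
  by apply/flattenP; exists (window_sites g j') => //; exact: map_f.
have p01' : 0 <= p <= 1 by move: p01; lra.
have -> : (1 - match_prob) ^+ N = E f.
  rewrite (expect_depends p01' point fd) /f.
  by rewrite (avg_no_match g point (iota_uniq 0 N)) size_iota.
apply: le_expect => //; first exact: depends_bm fd.
move=> x; rewrite /f; case: asboolP => [_|no]; first by rewrite subrr.
rewrite subr0 (_ : all _ _)//; apply/allP => j _; apply/negP => /matches_special sx.
by apply: no; exists (j * window_length)%N.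
Qed.

(** There are countably many walks, and [expect_recurrent] applies to each. *)
Lemma recurrent_almost_surely g : exists A : config G -> bool,
  [/\ mbool A, expect (product_measure kappa) (fun x => (A x)%:R) = 1 &
      forall x, A x -> recurrent (special x) g].
Proof.
pose f n x : bool :=
  `[< exists i, special x (site (g * walk (odflt [::] (unpickle n)))%g i) >].
have mf n : mbool (f n).
  by apply: (mbool_exists (f := fun i x => special x (site _ i))) => i; exact: mbool_special.
exists (fun x => `[< forall n, f n x >]); split; first exact: mbool_forall.
  pose u n x : R := (all (f ^~ x) (iota 0 n))%:R.
  have mu n : mbool (fun x => all (f ^~ x) (iota 0 n)) by exact: mbool_all.
  have u1 n : E (u n) = 1.
    elim: n => [|n IH]; first exact: expect_cst.
    rewrite -[RHS]IH; apply: (@expect_ae_eq _ _ _ _ _ _ (f n)).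
    - exact: bm_mbool.
    - exact: bm_mbool.
    - exact: mf.
    - exact: expect_recurrent.
    - by move=> x fx; rewrite /u -addn1 iotaD all_cat /= add0n fx /= andbT.
  have := @expect_bounded_cvg _ _ R (@product_measure R G kappa) u
    (fun x => (`[< forall n, f n x >])%:R) 1.
  rewrite (_ : (fun n => E (u n)) = fun=> 1); last exact/funext.
  move=> cv; have {cv}cv := cv _ _ _ _; apply: (cvg_unique _ (cv _ _ _ _) (cvg_cst _)) => //.
  - by move=> n; apply: bm_mbool.
  - by apply: bm_mbool; apply: mbool_forall.
  - by move=> n x; rewrite /u; case: (all _ _); rewrite ?normr1 ?normr0.
  move=> x; apply: cvg_near_cst; case: asboolP => [fx|/existsNP[n fn]].
    by apply: nearW => n; rewrite /u (_ : all _ _)//; apply/allP => i _; exact: fx.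
  exists n.+1 => // k /= nk; rewrite /u (_ : all _ _ = false)//; apply/negP => /allP fk.
  by apply: fn; apply: fk; rewrite mem_iota.
move=> x /asboolP fx w; have /asboolP := fx (pickle w).
by rewrite pickleK.
Qed.

(** * The extracted bits are independent fair coins *)

Definition sign (e : bool) : R := (-1) ^+ e.

Lemma sign_addb e e' : sign (e (+) e') = sign e * sign e'.
Proof. exact: signr_addb. Qed.

Lemma signE e : sign e = 1 - 2 * e%:R.
Proof. by rewrite /sign; case: e; rewrite /= ?expr1 ?expr0; ring. Qed.

Lemma bm_sign d (T : measurableType d) (f : T -> bool) : mbool f ->
  bounded_mfun (fun u => sign (f u)).
Proof.
move=> mf; under eq_fun do rewrite signE.
by apply: bmB; [exact: bm_cst|apply: bmZ; apply: bm_mbool].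
Qed.

Lemma recurrent_almost_surely_seq (t : seq (bit_index G)) : exists A : config G -> bool,
  [/\ mbool A, E (fun x => (A x)%:R) = 1 &
      forall x, A x -> forall v, v \in t -> recurrent (special x) v.1].
Proof.
elim: t => [|v t [A [mA A1 At]]].
  by exists (fun=> true); split=> //; [exact: mbool_cst|rewrite expect_cst].
have [B [mB B1 Bt]] := recurrent_almost_surely v.1.
exists (fun x => A x && B x); split; first exact: mboolI.
  have := @expect_ae_eq _ _ R (product_measure kappa)
    (fun x => (A x && B x)%:R) (fun x => (B x)%:R) A.
  rewrite B1; apply => //; [exact/bm_mbool/mboolI|exact: bm_mbool|].
  by move=> x ->.
move=> x /andP[Ax Bx] u; rewrite inE => /predU1P[->|]; first exact: Bt.
exact: At.
Qed.

(** An exchange at a site [h] preserves the expectation; restricted to the event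
    that [h] is a pivot, it changes the sign of the integrand, so this event
    contributes nothing. As pivots are invariant under exchanges, the argument
    applies successively to an enumeration of all sites that can be pivots, and
    almost surely one of them is a pivot. *)
Lemma expect_sign_parity t (Z : config G -> R) : uniq t -> t != [::] ->
  bounded_mfun Z -> (forall h x, Z (swap h x) = Z x) ->
  E (fun x => sign (parity t x (mark x)) * Z x) = 0.
Proof.
move=> ut tn bZ sZ.
have bs : bounded_mfun (fun x => sign (parity t x (mark x))).
  by apply: bm_sign; apply: mbool_parity => k; exact: mbool_mark.
(* [hn] enumerates the sites that the bits in [t] can read. *)
pose hn n : G := if unpickle n is Some (i, w) then
    ((nth (1%g, (0%N, 0%N)) t i).1 * walk w)%g else 1%g.
pose miss n x : bool := all (fun i => ~~ pivot t x (hn i)) (iota 0 n).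
have mmiss n : mbool (miss n).
  by apply: (mbool_all _ (f := fun i x => ~~ pivot t x (hn i))) => i;
    apply: mboolN; exact: mbool_pivot.
have bm_miss n : bounded_mfun (fun x => sign (parity t x (mark x)) * Z x * (miss n x)%:R).
  by apply: bmM; [apply: bmM|apply: bm_mbool].
have step n : E (fun x => sign (parity t x (mark x)) * Z x * (miss n x)%:R) =
    E (fun x => sign (parity t x (mark x)) * Z x).
  elim: n => [|n IH].
    by congr expect; apply/funext => x; rewrite mulr1.
  rewrite -[RHS]IH; apply/eqP; rewrite eq_sym -subr_eq0 -expectB//.
  set f := (fun x => _).
  have bf : bounded_mfun f by apply: bmB.
  have fE x : f x = sign (parity t x (mark x)) * Z x *
      ((miss n x)%:R * (pivot t x (hn n))%:R).
    rewrite /f /miss -addn1 iotaD all_cat /= andbT -!mulrBr add0n.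
    by congr (_ * _); case: (all _ _); case: (pivot _ _ _); rewrite /=; ring.
  have : E (fun x => f (swap (hn n) x)) = - E f.
    rewrite -mulN1r -expectZ//; congr expect; apply/funext => x.
    rewrite !fE sZ /miss; under eq_all do rewrite swap_pivot.
    rewrite swap_pivot swap_parity.
    case pv : (pivot t x (hn n)); last by rewrite !mulr0.
    have /andP[sp pa] := pv.
    by rewrite swap_mark// parityD pa addbT /sign signrN !mulNr mul1r.
  by rewrite (expect_swap)// => /eqP; rewrite -addr_eq0 -mulr2n mulrn_eq0.
(* The limit vanishes almost surely, because some [hn n] is a pivot. *)
pose f x := sign (parity t x (mark x)) * Z x * (`[< forall n, miss n x >])%:R.
have bf : bounded_mfun f.
  by apply: bmM; [exact: bmM|apply: bm_mbool; exact: mbool_forall].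
have f0 : E f = 0.
  have [A [mA A1 At]] := recurrent_almost_surely_seq t.
  transitivity (E (fun=> 0)); last exact: expect_cst.
  apply: (expect_ae_eq bf (bm_cst _ 0) mA A1) => x /At gt.
  rewrite /f; case: asboolP => [no|_]; last by rewrite mulr0.
  have [v [w [vt pv]]] := pivot_exists ut tn gt.
  have := no (pickle (index v t, w)).+1; rewrite /miss => /allP /(_ (pickle (index v t, w))).
  by rewrite mem_iota add0n ltnSn /hn pickleK nth_index// pv => /(_ isT).
have [_ [C fC]] := bmM bs bZ.
have C0 : 0 <= C by apply: le_trans (fC point).
have := @expect_bounded_cvg _ _ R (product_measure kappa)
  (fun n x => sign (parity t x (mark x)) * Z x * (miss n x)%:R) f C bm_miss bf.
rewrite (_ : (fun n => E _) = fun=> E (fun x => sign (parity t x (mark x)) * Z x)); last first.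
  by apply/funext => n; exact: step.
rewrite f0 => cv; apply/esym; apply: (cvg_unique _ (cv _ _)) => //; last exact: cvg_cst.
  move=> n x; case: (miss n x) => /=; last by rewrite mulr0 normr0.
  by rewrite mulr1; exact: fC.
move=> x; apply: cvg_near_cst; rewrite /f.
case: asboolP => [no|/existsNP[n no]]; first by apply: nearW => n; rewrite no.
exists n => // k /= nk; rewrite (_ : miss k x = false)//.
apply/negP => mk; apply: no; apply/allP => i; rewrite mem_iota => im.
by apply: (allP mk); rewrite mem_iota; lia.
Qed.

Hypotheses (r01 : 0 <= r <= 1) (theta01 : 0 <= theta <= 1).

Lemma mbool_fair_bit v : mbool (fun x => fair_bit x v).
Proof. by apply: mbool_bit => k; exact: mbool_mark. Qed.

Lemma parity_cons v t x : parity (v :: t) x (mark x) = fair_bit x v (+) parity t x (mark x).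
Proof. by rewrite /parity big_cons. Qed.

(** Expand [H x] as a function of one bit after another into its even part and its
    odd part, the latter being carried by the sign of the bit. All the terms that
    contain a sign vanish by [expect_sign_parity], and the one without signs is
    the average over fair bits. The list [t] holds the signs collected so far. *)
Lemma expect_fair_bits s : uniq s -> forall (H : config G -> config (bit_index G) -> R) t,
  uniq t -> (forall i, i \in s -> i \notin t) ->
  (forall c, bounded_mfun (H ^~ c)) -> (forall h x c, H (swap h x) c = H x c) ->
  (forall x, depends s (H x)) ->
  bounded_mfun (fun x => H x (fair_bit x)) /\
  E (fun x => sign (parity t x (mark x)) * H x (fair_bit x)) =
  if t is [::] then avg half s (fun c => E (H ^~ c)) point else 0.
Proof.
elim: s => [_|i s IH /= /andP[iNs us]] H t ut st bH sH dH.
  have HE x : H x (fair_bit x) = H x point by apply: dH.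
  under eq_fun do rewrite HE; split; first exact: bH.
  under eq_fun do rewrite HE.
  case: t ut {st} => [_|v t ut]; last exact: (expect_sign_parity ).
  by congr expect; apply/funext => x; rewrite /parity big_nil /sign expr0 mul1r.
(* The even and the odd part in the bit [i]. *)
pose A x c := 1 / 2 * (H x (update i true c) + H x (update i false c)).
pose B x c := 1 / 2 * (H x (update i false c) - H x (update i true c)).
have HAB x c : H x c = A x c + sign (c i) * B x c.
  rewrite /A /B -{1}(update_id i c) signE.
  by case: (c i); rewrite /= ?mulr1n ?mulr0n; field.
have bA c : bounded_mfun (A ^~ c) by apply: bmZ; apply: bmD; exact: bH.
have bB c : bounded_mfun (B ^~ c) by apply: bmZ; apply: bmB; exact: bH.
have sA h x c : A (swap h x) c = A x c by rewrite /A !sH.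
have sB h x c : B (swap h x) c = B x c by rewrite /B !sH.
have dA x : depends s (A x).
  by move=> c c' cc; rewrite /A !(depends_update _ (dH x) cc).
have dB x : depends s (B x).
  by move=> c c' cc; rewrite /B !(depends_update _ (dH x) cc).
have it : i \notin t by apply: st; rewrite mem_head.
have st' j : j \in s -> j \notin t by move=> js; apply: st; rewrite inE js orbT.
have [bAr EA] := IH us A t ut st' bA sA dA.
have uit : uniq (i :: t) by rewrite /= it.
have st'' j : j \in s -> j \notin i :: t.
  move=> js; rewrite inE negb_or st'// andbT.
  by apply: contraNneq iNs => <-.
have [bBr EB] := IH us B (i :: t) uit st'' bB sB dB.
have bs u : bounded_mfun (fun x => sign (parity u x (mark x))).
  by apply: bm_sign; apply: mbool_parity => k; exact: mbool_mark.
have bsi : bounded_mfun (fun x => sign (fair_bit x i)) by apply: bm_sign; exact: mbool_fair_bit.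
under eq_fun do rewrite HAB; split.
  by apply: bmD => //; exact: bmM.
have -> : (fun x => sign (parity t x (mark x)) * H x (fair_bit x)) =
    fun x => sign (parity t x (mark x)) * A x (fair_bit x) +
             sign (parity (i :: t) x (mark x)) * B x (fair_bit x).
  apply/funext => x; rewrite HAB parity_cons sign_addb; ring.
rewrite expectD; [|exact: bmM..].
rewrite EB addr0 EA; case: (t) => //.
rewrite /= avg1_avgC; congr (avg _ _ _ _); apply/funext => c.
by rewrite /A expectZ ?expectD ?/avg1 //; [field|apply: bmD].
Qed.

(** * The thinning driven by the extracted coins *)

Definition extracted_coins x : config var :=
  fun v => `[< exists n, coins weight n (fair_bit x) v >].

Lemma weight01 (v : var) : 0 <= weight v <= 1.
Proof. by case: v => g [|[|[|k]]]; rewrite /weight //=; lra. Qed.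

Lemma mbool_extracted_coins v : mbool (fun x => extracted_coins x v).
Proof.
apply: (mbool_exists (f := fun n x => coins weight n (fair_bit x) v)) => n.
apply: (mbool_coin _ _ (c := fun x l => fair_bit x (v.1, (v.2, l)))) => l.
exact: mbool_fair_bit.
Qed.

Lemma mbool_combine (c : config G -> config var) v : (forall v, mbool (c ^~ v)) ->
  mbool (fun x => combine x (c x) v).
Proof. by move=> mc; rewrite /combine; case: (v.2 == _); [exact: mbool_coord|exact: mc]. Qed.

Lemma coins_eventually (V : seq var) x : exists N, forall n, (N <= n)%N ->
  forall v, v \in V -> coins weight n (fair_bit x) v = extracted_coins x v.
Proof.
elim: V => [|v V [N NV]]; first by exists 0%N.
have [M MV] : exists M, forall n, (M <= n)%N ->
      coins weight n (fair_bit x) v = extracted_coins x v.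
  case g : (extracted_coins x v); last first.
    by exists 0%N => n _; apply/negbTE/negP => cn; move/asboolP: g; apply; exists n.
  by move/asboolP: g => [M cM]; exists M => n Mn; exact: coin_le Mn cM.
exists (maxn N M) => n; rewrite geq_max => /andP[Nn Mn] u.
by rewrite inE => /predU1P[->|]; [exact: MV|exact: NV].
Qed.

Lemma combine_depends (V : seq var) (T : Type) (h : config var -> T) c : depends V h ->
  depends [seq v.1 | v <- V] (fun x => h (combine x c)).
Proof.
move=> hV x y xy; apply: hV => v vV; rewrite /combine; case: ifP => // _.
by apply: xy; apply: map_f.
Qed.

Lemma expect_combine_coins (V : seq var) (h : config var -> R) n : depends V h ->
  (forall g x c, h (combine (swap g x) c) = h (combine x c)) ->
  E (fun x => h (combine x (coins weight n (fair_bit x)))) =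
  avg (fun v => coin_mean n (weight v)) V (fun c => E (fun x => h (combine x c))) point.
Proof.
move=> hV hs; set k := (fun c => E _).
pose L := flatten [seq coin_bits n v | v <- V].
have kV : depends V k.
  move=> c c' cc; congr expect; apply/funext => x; apply: hV => v vV.
  by rewrite /combine cc.
have hL x : depends L (fun c => h (combine x (coins weight n c))).
  apply: (@coins_depends R G weight n V _ (fun c => h (combine x c))) => c c' cc.
  by apply: hV => v vV; rewrite /combine cc.
have hU x : depends (undup L) (fun c => h (combine x (coins weight n c))).
  by apply: sub_depends (hL x) => u; rewrite mem_undup.
have [_] := expect_fair_bits (undup_uniq L) (H := fun x c => h (combine x (coins weight n c)))
  (t := [::]) isT (fun i _ => isT) (fun c => depends_bm (combine_depends _ hV))
  (fun g x c => hs g x _) hU.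
under [X in expect _ X]eq_fun do rewrite /parity big_nil /sign expr0 mul1r.
move=> ->.
have kL : depends L (fun c => k (coins weight n c)) by exact: coins_depends.
rewrite (avg_indep _ (t := L) point point)//; last first.
  by apply: sub_depends kL => u; rewrite mem_undup.
by rewrite (avg_coins weight n V k point); apply: avg_const.
Qed.

(** Averaging first over the coins and then over the input is the same as
    averaging over all the layers at once. *)
Lemma avg_combine (V : seq var) (h : config var -> R) : depends V h ->
  avg weight V (fun c => E (fun x => h (combine x c))) point = avg weight V h point.
Proof.
move=> hV; pose X : seq var := [seq (g, 0%N) | g <- [seq v.1 | v <- V]].
pose h' := avg weight X h.
have Eh c : E (fun x => h (combine x c)) = h' (combine point c).
  rewrite (expect_depends p_ge0_le1 point (combine_depends c hV)) /h' /X.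
  elim: [seq v.1 | v <- V] (point : config G) => //= g l IH x.
  have up e : combine (update g e x) c = update (g, 0%N) e (combine x c).
    apply/funext => -[g' k]; rewrite /combine /update /= xpair_eqE.
    by case: k => [|k] /=; rewrite ?andbT ?andbF.
  by rewrite /avg1 -/(avg _ _ _) !IH !up.
have hc c : h' (combine point c) = h' c.
  pose t := [seq v <- V | v \notin X].
  apply: (@avg_depends R var weight X t h).
    by apply: sub_depends hV => v vV; rewrite mem_cat mem_filter vV andbT; case: (v \in X).
  move=> v; rewrite mem_filter => /andP[vX vV]; rewrite /combine; case: eqP => // v0.
  move/negP: vX; case; apply/mapP; exists v.1; first exact: map_f.
  by case: (v) v0 => ? ? /= ->.
rewrite (_ : (fun c => _) = h'); last by apply/funext => c; rewrite Eh hc.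
rewrite /h' avgC avg_id// => u e z _; exact: avg_const.
Qed.

(** Coins that look at finitely many bits have the right joint law up to their
    means; let the number of bits tend to infinity. *)
Lemma expect_combine (V : seq var) (h : config var -> R) : depends V h ->
  (forall g x c, h (combine (swap g x) c) = h (combine x c)) ->
  E (fun x => h (combine x (extracted_coins x))) = avg weight V h point.
Proof.
move=> hV hs; rewrite -avg_combine//; set k := (fun c => E _).
have bh := depends_bm hV; have [_ [C hC]] := bh.
have bc (c : config G -> config var) : (forall v, mbool (c ^~ v)) ->
    bounded_mfun (fun x => h (combine x (c x))).
  by move=> mc; apply: bm_comp_config => // v; exact: mbool_combine.
have lim1 : (fun n => E (fun x => h (combine x (coins weight n (fair_bit x))))) @ \oo -->
    E (fun x => h (combine x (extracted_coins x))).
  apply: (@expect_bounded_cvg _ _ _ _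
      (fun n x => h (combine x (coins weight n (fair_bit x)))) _ C) => // [n||x].
  - apply: bc => v; apply: (mbool_coin _ _ (c := fun x l => fair_bit x (v.1, (v.2, l)))) => l.
    exact: mbool_fair_bit.
  - by apply: bc; exact: mbool_extracted_coins.
  - apply: cvg_near_cst; have [N HN] := coins_eventually V x.
    exists N => // n /= Nn; apply: hV => v vV.
    by rewrite /combine; case: ifP => // _; exact: HN.
have lim2 : (fun n => E (fun x => h (combine x (coins weight n (fair_bit x))))) @ \oo -->
    avg weight V k point.
  rewrite (_ : (fun n => _) = fun n =>
      avg (fun v => coin_mean n (weight v)) V k point); last first.
    by apply/funext => n; exact: expect_combine_coins.
  by apply: avg_cvg => v; apply: coin_mean_cvg; exact: weight01.
exact: (cvg_unique _ lim1 lim2).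
Qed.

(** * Equivariance *)

Lemma translate_site g x h i : translate g x (site h i) = x (site (g^-1 * h)%g i).
Proof. by rewrite /translate /site mulgA. Qed.

Lemma translate_occ g x h : occ (translate g x) h = occ x (g^-1 * h)%g.
Proof.
rewrite /occ !translate_site; congr (_ && _); apply: eq_all => i.
exact: translate_site.
Qed.

Lemma translate_special g x :
  special (translate g x) = fun h => special x (g^-1 * h)%g.
Proof.
apply/funext => h; rewrite /special /base translate_occ /pair_site !translate_site.
congr (_ && _ && _); rewrite !all_map; apply: eq_all => i /=.
by rewrite translate_site.
Qed.

Lemma translate_gap g (K : G -> bool) h :
  gap (fun h => K (g^-1 * h)%g) h = gap K (g^-1 * h)%g.
Proof. by congr first_index; apply/funext => i; rewrite /site mulgA. Qed.

Lemma translate_next g (K : G -> bool) h :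
  (g^-1 * next_site (fun h => K (g^-1 * h)) h)%g = next_site K (g^-1 * h)%g.
Proof. by rewrite /next_site translate_gap /site mulgA. Qed.

Lemma translate_level g (K f : G -> bool) n h :
  level (fun h => K (g^-1 * h)%g) (fun h => f (g^-1 * h)%g) n h =
  level K f n (g^-1 * h)%g.
Proof.
elim: n h => //= n IH h.
by rewrite /diff_b -!/(level _ _ _) !IH translate_next mulgA.
Qed.

Lemma translate_bit g (K f : G -> bool) h j :
  bit (fun h => K (g^-1 * h)%g) (fun h => f (g^-1 * h)%g) (h, j) =
  bit K f (g^-1 * h, j)%g.
Proof.
by rewrite /bit /diff_a !translate_level /= translate_gap !translate_next mulgA translate_next.
Qed.

Lemma translate_fair_bit g x h j :
  fair_bit (translate g x) (h, j) = fair_bit x (g^-1 * h, j)%g.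
Proof.
rewrite /fair_bit translate_special -translate_bit; congr (bit _ _ _).
by apply/funext => k; rewrite /mark translate_special /pair_site translate_site.
Qed.

Lemma translate_coins n g x h (l : nat) :
  coins (weight) n (fair_bit (translate g x)) (h, l) =
  coins (weight) n (fair_bit x) (g^-1 * h, l)%g.
Proof. by congr coin; apply/funext => i; exact: translate_fair_bit. Qed.

Lemma translate_extracted_coins g x h (l : nat) :
  extracted_coins (translate g x) (h, l) =
  extracted_coins x (g^-1 * h, l)%g.
Proof.
congr asbool; apply/propext; split => -[n cn]; exists n; move: cn;
  by rewrite translate_coins.
Qed.

Lemma translate_thin g (z z' : config (G * nat)%type) h :
  (forall h (l : nat), z' (h, l) = z (g^-1 * h, l)%g) ->
  thin predT z' h = thin predT z (g^-1 * h)%g.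
Proof.
move=> zz; have xz : input z' = translate g (input z) by apply/funext => k; exact: zz.
have pl k : plain z' k = plain z (g^-1 * k)%g by rewrite /plain !zz.
have co k : compensated z' k = compensated z (g^-1 * k)%g.
  rewrite /compensated xz translate_occ !zz /pair_site /site !mulgA.
  do 5 congr (_ && _); congr (_ && _); rewrite !all_map; apply: eq_all => i /=.
  by rewrite pl /site mulgA.
by rewrite /thin /= xz translate_special !co !zz pl /owner !mulgA.
Qed.

(** * The thinning map *)

Definition thinning x : config G := fun g => thin predT (combine x (extracted_coins x)) g.

Lemma mbool_thinning g : mbool (fun x => thinning x g).
Proof.
apply: (mbool_comp_config (h := fun z => thin predT z g)).
  by move=> v; apply: mbool_combine => u; exact: mbool_extracted_coins.
exact: depends_mbool (@thin_depends predT g).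
Qed.

Lemma thinning_le x g : (thinning x g <= x g)%N.
Proof.
have := @thin_le predT (combine x (extracted_coins x)) g.
by rewrite /thinning -[input _ g]/(x g); case: (thin _ _ _) => // ->.
Qed.

(** By [swap_thin], the event that all sites of [s] are kept is invariant under
    exchanges when the coins are held fixed; so the extracted coins may be
    replaced by independent ones. *)
Lemma expect_thinning s : uniq s ->
  E (fun x => (all (thinning x) s)%:R) = (p * r) ^+ size s.
Proof.
move=> us; pose V := flatten [seq thin_support g | g <- s].
have dep Q : depends V (fun z => all (thin Q z) s).
  apply: (depends_all (f := fun g z => thin Q z g)) => g gs.
  apply: sub_depends (@thin_depends Q g) => v vg.
  by apply/flattenP; exists (thin_support g) => //; exact: map_f.
rewrite -(avg_all_thin point us dep).
apply: (expect_combine (h := fun z => (all (thin predT z) s)%:R)).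
  exact: (depends_comp (fun e : bool => e%:R) (dep predT)).
move=> g x c; congr ((nat_of_bool _)%:R); apply: eq_all => h.
exact: swap_thin.
Qed.

Lemma thinning_translate g x : thinning (translate g x) = translate g (thinning x).
Proof.
apply/funext => h; apply: translate_thin => k [|l]; first by [].
exact: translate_extracted_coins.
Qed.

End construction.

Lemma two_elements (T : Type) (S : set T) : (`I_2 #<= S)%card ->
  exists a b, [/\ S a, S b & a <> b].
Proof.
move=> /card_leP/unsquash f.
have i0 : (0%N : nat) \in `I_2 by rewrite inE.
have i1 : (1%N : nat) \in `I_2 by rewrite inE.
exists (val (f (SigSub i0))), (val (f (SigSub i1))); split.
- exact: set_valP.
- exact: set_valP.
- by move=> /val_inj /inj => /(_ (mem_set I) (mem_set I)) [].
Qed.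

Lemma power_small (R : realType) (c e : R) : 0 <= c < 1 -> 0 < e ->
  exists n, c ^+ n < e.
Proof.
move=> c01 e0; have lim : (fun n => c ^+ n) @ \oo --> (0 : R).
  by apply: cvg_expr; rewrite ger0_norm; lra.
by have [N _ /(_ N (leqnn N))] := cvgr_lt _ lim _ e0; exists N.
Qed.

(** Solving the equation for theta gives ((1 - p) / (1 - q))^m up to a factor that
    does not depend on m. *)
Lemma compensation_exists (R : realType) (p q : R) : 0 < q -> q < p -> p < 1 ->
  exists m theta, 0 <= theta <= 1 /\
  p ^+ 2 * (1 - q / p) ^+ 2 * (1 - p * (q / p)) ^+ m * (theta / 2) =
  p * (q / p) * (1 - p) * (1 - p) ^+ m.
Proof.
move=> q0 qp p1; have p0 : 0 < p by lra.
have pq : p * (q / p) = q by field; lra.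
have qp1 : 1 - q / p = (p - q) / p by field; lra.
(* With this e, theta is ((1 - p) / (1 - q))^m / e. *)
pose e := (p - q) ^+ 2 / (2 * q * (1 - p)).
have e0 : 0 < e by rewrite divr_gt0 ?exprn_gt0 ?mulr_gt0//; lra.
have c01 : 0 <= (1 - p) / (1 - q) < 1.
  by rewrite divr_ge0 ?ltr_pdivrMr/=; lra.
have [m mP] := power_small c01 e0.
exists m, (((1 - p) / (1 - q)) ^+ m / e).
have cm0 : 0 <= ((1 - p) / (1 - q)) ^+ m by apply: exprn_ge0; case/andP: c01.
split.
  apply/andP; split; first exact: divr_ge0 (ltW e0).
  by rewrite ler_pdivrMr// mul1r ltW.
rewrite pq qp1 [((1 - p) / _) ^+ m]expr_div_n /e.
have : (1 - q) ^+ m != 0 by rewrite expf_neq0//; lra.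
move: ((1 - q) ^+ m) ((1 - p) ^+ m) => u v u0.
by field; rewrite ?u0 /=; lra.
Qed.

Local Open Scope ereal_scope.

Theorem theorem1 (R : realType) (kappa iota : probability bool R)
  (kappa01 : 0 < kappa [set true] < 1)
  (iota01 : 0 < iota [set true] < 1)
  (iota_lt_kappa : iota [set true] < kappa [set true])
  (G : groupType) (S : set G) (S_basis : free_basis S)
  (rank_ge2 : (`I_2 #<= S)%card) :
  exists phi : config G -> config G,
    [/\ measurable_fun setT phi,
        forall (x : config G) (g : G), (phi x g <= x g)%N,
        forall A : set (config G), measurable A ->
          pushforward (product_measure kappa) phi A = product_measure iota A
      & {ae product_measure kappa, forall (x : config G) (g : G),
          phi (translate g x) = translate g (phi x)}].
Proof.
have [a [a' [Sa Sa' /eqP aa']]] := two_elements rank_ge2.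
move: kappa01 iota01 iota_lt_kappa.
rewrite (kappa_trueE kappa) (kappa_trueE iota) !lte_fin.
set p := fine (kappa _); set q := fine (iota _) => /andP[p0 p1] /andP[q0 q1] qp.
have p01 : (0 < p < 1)%R by rewrite p0.
have [m [theta [theta01 balance]]] := compensation_exists q0 qp p1.
have r01 : (0 <= q / p <= 1)%R.
  by rewrite divr_ge0 ?(ltW q0) ?(ltW p0)//= ler_pdivrMr// mul1r ltW.
pose phi := @thinning G a a' m R kappa (q / p)%R theta.
have mphi g : mbool (fun x => phi x g) by exact: mbool_thinning.
exists phi; split.
- exact: config_measurable.
- by move=> x g; exact: thinning_le.
- apply: (product_measure_unique_ones
    (m := measure_function_pushforward__canonical__measure_function_Measure
            (product_measure kappa) (config_measurable mphi))) => s us.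
  have pr : (p * (q / p) = q)%R by rewrite mulrCA divff ?gt_eqF// mulr1.
  rewrite -/q -pr -(expect_thinning S_basis Sa Sa' aa' balance p01 r01 theta01 us).
  rewrite expect_mbool; last by apply: mbool_all => g; exact: mphi.
  by congr (product_measure kappa _); apply/seteqP; split => x /= /allP.
- by apply: aeW => x g; exact: thinning_translate.
Qed.
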